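(* Let $B$ be a locally multipermutational two-sided skew brace. If $B$ is i-artinian, then $B$ is s-artinian. Moreover, in that case $B$ is a hypercentral and soluble skew brace.
   Context: A skew brace is a set $B$ with two group operations $+$ and $\cdot$ (the latter written by juxtaposition; $+$ need not be commutative) such that $a(b+c)=ab-a+ac$ for all $a,b,c\in B$; both groups have the same identity, denoted $0$. It is two-sided if moreover $(b+c)a=ba-a+ca$ for all $a,b,c\in B$. For $a,b\in B$ put $\lambda_a(b)=-a+ab$. A subbrace of $B$ is a subset that is a subgroup of both $(B,+)$ and $(B,\cdot)$. An ideal is a subbrace $I$ with $(I,+)\unlhd(B,+)$, $(I,\cdot)\unlhd(B,\cdot)$ and $\lambda_a(I)\subseteq I$ for all $a\in B$; then $B/I$ is a skew brace. A subbrace is finitely generated if it is the intersection of all subbraces containing some finite set. $B$ is i-artinian (resp. s-artinian) if it satisfies the minimal condition, i.e. the descending chain condition, on ideals (resp. on subbraces). Define the ideals $\operatorname{Soc}(B)=\{a\in B\mid ab=a+b=b+a\ \ \forall b\in B\}$ and $\zeta(B)=\{a\in B\mid ab=ba=a+b=b+a\ \ \forall b\in B\}$. The socle series and the central series are the ascending ordinal series with $\operatorname{Soc}_0(B)=\zeta_0(B)=0$, $\operatorname{Soc}_{\alpha+1}(B)/\operatorname{Soc}_\alpha(B)=\operatorname{Soc}(B/\operatorname{Soc}_\alpha(B))$, $\zeta_{\alpha+1}(B)/\zeta_\alpha(B)=\zeta(B/\zeta_\alpha(B))$, and unions at limit ordinals. A skew brace $A$ has finite multipermutational level if $\operatorname{Soc}_n(A)=A$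 for some natural number $n$; $B$ is locally multipermutational if every finitely generated subbrace of $B$ has finite multipermutational level. $B$ is hypercentral if $\zeta_\alpha(B)=B$ for some ordinal $\alpha$. A skew brace $A$ is abelian if $\zeta(A)=A$. $B$ is soluble if there is a finite series of ideals of $B$, $0=I_0\leq I_1\leq\cdots\leq I_n=B$, such that $I_j/I_{j-1}$ is an abelian skew brace for every $1\le j\le n$. *)

(* Defs.v *)
From HB Require Import structures.
From mathcomp Require Import all_boot.
From mathcomp Require Import mathcomp_extra boolp classical_sets functions.
From mathcomp Require Import cardinality wochoice.

Set Implicit Arguments.
Unset Strict Implicit.
Unset Printing Implicit Defensive.

Local Open Scope classical_set_scope.
Local Open Scope group_scope.

(* The multiplicative group is the groupType structure of B. Its unit is also
   the unit of the additive group, which is not assumed to be commutative. *)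
HB.mixin Record Group_isSkewBrace B of Group B := {
  addb : B -> B -> B;
  oppb : B -> B;
  addbA : associative addb;
  add0b : left_id (1 : B) addb;
  addNb : left_inverse (1 : B) oppb addb;
  mulbDr : forall a b c : B,
    a * addb b c = addb (addb (a * b) (oppb a)) (a * c) }.

#[short(type="skewBraceType")]
HB.structure Definition SkewBrace := {B of Group_isSkewBrace B & Group B}.

Declare Scope brace_scope.
Delimit Scope brace_scope with SB.
Bind Scope brace_scope with SkewBrace.sort.
Notation "0" := (@monoid.one _) : brace_scope.
Notation "a + b" := (addb a b) : brace_scope.
Notation "- a" := (oppb a) : brace_scope.
Notation "a - b" := (addb a (oppb b)) : brace_scope.
Local Open Scope brace_scope.

(* An alias of B which carries the additive group of B as its groupType
   structure. *)
Definition addg (B : Type) : Type := B.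

Section AdditiveGroup.
Variable B : skewBraceType.

Lemma addbN : right_inverse (0 : B) oppb addb.
Proof.
move=> x; rewrite -[x - x]add0b -(addNb (- x)) -!addbA.
by rewrite (addbA (- x) x) addNb add0b.
Qed.

Lemma addb0 : right_id (0 : B) addb.
Proof. by move=> x; rewrite -(addNb x) addbA addbN add0b. Qed.

HB.instance Definition _ := Choice.on (addg B).
HB.instance Definition _ :=
  isGroup.Build (addg B) (@addbA B) (@add0b B) (@addb0) (@addNb B) addbN.

Lemma addKb (a b : B) : - a + (a + b) = b.
Proof. exact: (@mulKg (addg B)). Qed.
Lemma addNKb (a b : B) : a + (- a + b) = b.
Proof. exact: (@mulVKg (addg B)). Qed.
Lemma addbK (a b : B) : b + a - a = b.
Proof. by rewrite -addbA addbN addb0. Qed.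
Lemma addbNK (a b : B) : b - a + a = b.
Proof. by rewrite -addbA addNb addb0. Qed.
Lemma oppbK (a : B) : - - a = a.
Proof. exact: (@invgK (addg B)). Qed.
Lemma oppbD (a b : B) : - (a + b) = - b - a.
Proof. exact: (@invgM (addg B)). Qed.
Lemma oppb0 : - 0 = 0 :> B.
Proof. exact: (@invg1 (addg B)). Qed.
Lemma addbI (a b c : B) : a + b = a + c -> b = c.
Proof. by move=> e; rewrite -(addKb a b) e addKb. Qed.

End AdditiveGroup.

Definition lambda (B : skewBraceType) (a b : B) : B := - a + a * b.

Section Lambda.
Variable B : skewBraceType.
Implicit Types a b c : B.

Lemma mulb_lambda a b : a * b = a + lambda a b.
Proof. by rewrite /lambda addNKb. Qed.

Lemma lambdaD a b c : lambda a (b + c) = lambda a b + lambda a c.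
Proof. by rewrite /lambda mulbDr !addbA. Qed.

Lemma lambda0 a : lambda a 0 = 0.
Proof. by rewrite /lambda mulg1 addNb. Qed.

Lemma lambdaN a b : lambda a (- b) = - lambda a b.
Proof. by apply: (@addbI _ (lambda a b)); rewrite -lambdaD !addbN lambda0. Qed.

Lemma lambda1 b : lambda 1 b = b.
Proof. by rewrite /lambda mul1g oppb0 add0b. Qed.

Lemma lambdaM a b c : lambda (a * b) c = lambda a (lambda b c).
Proof.
by rewrite {3}/lambda lambdaD lambdaN /lambda oppbD oppbK -!addbA addNKb mulgA.
Qed.

Lemma lambdaK a b : lambda a (lambda a^-1 b) = b.
Proof. by rewrite -lambdaM mulgV lambda1. Qed.

Lemma lambdaVK a b : lambda a^-1 (lambda a b) = b.
Proof. by rewrite -lambdaM mulVg lambda1. Qed.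

Lemma addb_lambda a b : a + b = a * lambda a^-1 b.
Proof. by rewrite mulb_lambda lambdaK. Qed.

End Lambda.

Definition two_sided (B : skewBraceType) : Prop :=
  forall a b c : B, (b + c) * a = b * a - a + c * a.

Definition is_subgroup (G : groupType) (S : set G) : Prop :=
  [/\ S 1, forall x y, S x -> S y -> S (x * y) & forall x, S x -> S x^-1].

Definition is_normal (G : groupType) (N : set G) : Prop :=
  is_subgroup N /\ forall x g, N x -> N (x ^ g).

Definition is_subbrace (B : skewBraceType) (S : set B) : Prop :=
  is_subgroup (S : set (addg B)) /\ is_subgroup S.

Definition is_ideal (B : skewBraceType) (I : set B) : Prop :=
  [/\ is_subbrace I, is_normal (I : set (addg B)), is_normal I
    & forall a x, I x -> I (lambda a x)].

Record subbrace (B : skewBraceType) := Subbrace {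
  subbrace_set :> set B;
  subbraceP : is_subbrace subbrace_set }.

Record ideal (B : skewBraceType) := Ideal {
  ideal_subbrace :> subbrace B;
  idealP : is_ideal ideal_subbrace }.

Definition ideal_of_set (B : skewBraceType) (I : set B) (hI : is_ideal I) :
    ideal B :=
  @Ideal B (@Subbrace B I (let: And4 h _ _ _ := hI in h)) hI.

Definition is_brace_morphism (B C : skewBraceType) (f : B -> C) : Prop :=
  (forall a b, f (a + b) = f a + f b) /\ (forall a b, f (a * b) = f a * f b).

Section SubbraceTheory.
Variables (B : skewBraceType) (S : subbrace B).

Lemma sub0 : subbrace_set S 0. Proof. by case: (subbraceP S) => [[]]. Qed.
Lemma subD a b : subbrace_set S a -> subbrace_set S b -> subbrace_set S (a + b).
Proof. by case: (subbraceP S) => [[_ h _] _]; apply: h. Qed.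
Lemma subN a : subbrace_set S a -> subbrace_set S (- a).
Proof. by case: (subbraceP S) => [[_ _ h] _]; apply: h. Qed.
Lemma subM a b : subbrace_set S a -> subbrace_set S b -> subbrace_set S (a * b).
Proof. by case: (subbraceP S) => [_ [_ h _]]; apply: h. Qed.
Lemma subV a : subbrace_set S a -> subbrace_set S a^-1.
Proof. by case: (subbraceP S) => [_ [_ _ h]]; apply: h. Qed.

Definition subbrace_type : Type := {x : B | subbrace_set S x}.
Definition incl (x : subbrace_type) : B := proj1_sig x.

Lemma incl_inj : injective incl.
Proof.
by move=> [x Sx] [y Sy] /= e; subst y; rewrite (Prop_irrelevance Sx Sy).
Qed.

Definition sub_one : subbrace_type := exist _ _ sub0.
Definition sub_mul (x y : subbrace_type) : subbrace_type :=
  exist _ _ (subM (proj2_sig x) (proj2_sig y)).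
Definition sub_inv (x : subbrace_type) : subbrace_type :=
  exist _ _ (subV (proj2_sig x)).
Definition sub_add (x y : subbrace_type) : subbrace_type :=
  exist _ _ (subD (proj2_sig x) (proj2_sig y)).
Definition sub_opp (x : subbrace_type) : subbrace_type :=
  exist _ _ (subN (proj2_sig x)).

Fact sub_mulA : associative sub_mul.
Proof. by move=> x y z; apply: incl_inj; apply: mulgA. Qed.
Fact sub_mul1l : left_id sub_one sub_mul.
Proof. by move=> x; apply: incl_inj; apply: mul1g. Qed.
Fact sub_mul1r : right_id sub_one sub_mul.
Proof. by move=> x; apply: incl_inj; apply: mulg1. Qed.
Fact sub_mulVl : left_inverse sub_one sub_inv sub_mul.
Proof. by move=> x; apply: incl_inj; apply: mulVg. Qed.
Fact sub_mulVr : right_inverse sub_one sub_inv sub_mul.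
Proof. by move=> x; apply: incl_inj; apply: mulgV. Qed.

HB.instance Definition _ := gen_eqMixin subbrace_type.
HB.instance Definition _ := gen_choiceMixin subbrace_type.
HB.instance Definition _ := isGroup.Build subbrace_type
  sub_mulA sub_mul1l sub_mul1r sub_mulVl sub_mulVr.

Fact sub_addA : associative sub_add.
Proof. by move=> x y z; apply: incl_inj; apply: addbA. Qed.
Fact sub_add0 : left_id (1 : subbrace_type) sub_add.
Proof. by move=> x; apply: incl_inj; apply: add0b. Qed.
Fact sub_addN : left_inverse (1 : subbrace_type) sub_opp sub_add.
Proof. by move=> x; apply: incl_inj; apply: addNb. Qed.
Fact sub_mulDr (a b c : subbrace_type) :
  a * sub_add b c = sub_add (sub_add (a * b) (sub_opp a)) (a * c).
Proof. by apply: incl_inj; apply: mulbDr. Qed.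

HB.instance Definition _ := Group_isSkewBrace.Build subbrace_type
  sub_addA sub_add0 sub_addN sub_mulDr.

Definition subbrace_brace : skewBraceType := subbrace_type.

Lemma incl_morph : is_brace_morphism (incl : subbrace_brace -> B).
Proof. by []. Qed.

End SubbraceTheory.

Section IdealTheory.
Variables (B : skewBraceType) (I : ideal B).
Implicit Types a b x : B.

Lemma ideal_lambda a x : subbrace_set I x -> subbrace_set I (lambda a x).
Proof. by case: (idealP I) => [_ _ _]; apply. Qed.

Lemma ideal_conj a x : subbrace_set I x -> subbrace_set I (x ^ a).
Proof. by case: (idealP I) => [_ _ [_ h] _]; apply: h. Qed.

Lemma ideal_addconj a x : subbrace_set I x -> subbrace_set I (- a + (x + a)).
Proof. by case: (idealP I) => [_ [_ h] _ _] Ix; apply: (h x a Ix). Qed.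

Definition coset a : set B := [set a + x | x in I].

Lemma cosetP a b : coset a b <-> subbrace_set I (- a + b).
Proof.
split; first by move=> [x Ix <-]; rewrite addKb.
by move=> Iab; exists (- a + b); rewrite // addNKb.
Qed.

Lemma eq_coset a b : coset a = coset b <-> subbrace_set I (- a + b).
Proof.
split=> [e|Iab].
  by apply/cosetP; rewrite e; apply/cosetP; rewrite addNb; apply: sub0.
rewrite predeqE => c; rewrite !cosetP; split=> h.
  have -> : - b + c = - (- a + b) + (- a + c).
    by rewrite oppbD oppbK -addbA addNKb.
  by apply: subD; first exact: subN.
have -> : - a + c = (- a + b) + (- b + c) by rewrite -addbA addNKb.
exact: subD.
Qed.

Lemma eq_cosetM a b : coset a = coset b <-> subbrace_set I (a^-1 * b).
Proof.
have e : lambda a (a^-1 * b) = - a + b by rewrite /lambda mulVKg.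
rewrite eq_coset -e; split; last exact: ideal_lambda.
by move/(ideal_lambda a^-1); rewrite lambdaVK.
Qed.

Definition quotient_type : Type := {C : set B | exists a, C = coset a}.

Definition proj a : quotient_type := exist _ (coset a) (ex_intro _ a erefl).

Definition quo_repr (q : quotient_type) : B := proj1_sig (cid (proj2_sig q)).

Lemma eq_proj a b : proj a = proj b <-> coset a = coset b.
Proof.
split=> [[]//|]; rewrite /proj => e; move: (ex_intro _ a _) (ex_intro _ b _).
by rewrite e => p q; rewrite (Prop_irrelevance p q).
Qed.

Lemma quo_reprK q : proj (quo_repr q) = q.
Proof.
case: q => C hC; rewrite /quo_repr /=; case: cid => a /= e.
by subst C; rewrite /proj; congr exist; apply: Prop_irrelevance.
Qed.

Lemma coset_repr a : coset (quo_repr (proj a)) = coset a.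
Proof. by apply/eq_proj; rewrite quo_reprK. Qed.

Lemma proj_surj q : exists a, q = proj a.
Proof. by exists (quo_repr q); rewrite quo_reprK. Qed.

Definition quo_one : quotient_type := proj 0.
Definition quo_add (p q : quotient_type) := proj (quo_repr p + quo_repr q).
Definition quo_opp (p : quotient_type) := proj (- quo_repr p).
Definition quo_mul (p q : quotient_type) := proj (quo_repr p * quo_repr q).
Definition quo_inv (p : quotient_type) := proj (quo_repr p)^-1.

Lemma quo_addE a b : quo_add (proj a) (proj b) = proj (a + b).
Proof.
apply/eq_proj/eq_coset; move: (coset_repr a) (coset_repr b).
set a' := quo_repr _; set b' := quo_repr _ => /eq_coset Ia /eq_coset Ib.
have -> : - (a' + b') + (a + b)
   = (- b' + ((- a' + a) + b')) + (- b' + b).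
  by rewrite oppbD -!addbA addNKb.
by apply: subD => //; apply: ideal_addconj.
Qed.

Lemma quo_oppE a : quo_opp (proj a) = proj (- a).
Proof.
apply/eq_proj/eq_coset; move: (coset_repr a).
set a' := quo_repr _ => /eq_coset Ia; rewrite oppbK.
have -> : a' - a = - (- - a + ((- a' + a) - a)) by rewrite addbK oppbD !oppbK.
by apply: subN; apply: ideal_addconj.
Qed.

Lemma quo_mulE a b : quo_mul (proj a) (proj b) = proj (a * b).
Proof.
apply/eq_proj/eq_cosetM; move: (coset_repr a) (coset_repr b).
set a' := quo_repr _; set b' := quo_repr _ => /eq_cosetM Ia /eq_cosetM Ib.
have -> : (a' * b')^-1 * (a * b) = (a'^-1 * a) ^ b' * (b'^-1 * b).
  by rewrite invgM /conjg -!mulgA mulVKg.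
by apply: subM => //; apply: ideal_conj.
Qed.

Lemma quo_invE a : quo_inv (proj a) = proj a^-1.
Proof.
apply/eq_proj/eq_cosetM; move: (coset_repr a).
set a' := quo_repr _ => /eq_cosetM Ia; rewrite invgK.
have -> : a' * a^-1 = ((a'^-1 * a) ^ a^-1)^-1.
  by rewrite /conjg invgK mulgK !invgM !invgK.
by apply: subV; apply: ideal_conj.
Qed.

Fact quo_mulA : associative quo_mul.
Proof.
move=> p q r; rewrite -(quo_reprK p) -(quo_reprK q) -(quo_reprK r).
by rewrite !quo_mulE mulgA.
Qed.
Fact quo_mul1l : left_id quo_one quo_mul.
Proof. by move=> p; rewrite -(quo_reprK p) quo_mulE mul1g. Qed.
Fact quo_mul1r : right_id quo_one quo_mul.
Proof. by move=> p; rewrite -(quo_reprK p) quo_mulE mulg1. Qed.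
Fact quo_mulVl : left_inverse quo_one quo_inv quo_mul.
Proof. by move=> p; rewrite -(quo_reprK p) quo_invE quo_mulE mulVg. Qed.
Fact quo_mulVr : right_inverse quo_one quo_inv quo_mul.
Proof. by move=> p; rewrite -(quo_reprK p) quo_invE quo_mulE mulgV. Qed.

HB.instance Definition _ := gen_eqMixin quotient_type.
HB.instance Definition _ := gen_choiceMixin quotient_type.
HB.instance Definition _ := isGroup.Build quotient_type
  quo_mulA quo_mul1l quo_mul1r quo_mulVl quo_mulVr.

Fact quo_addA : associative quo_add.
Proof.
move=> p q r; rewrite -(quo_reprK p) -(quo_reprK q) -(quo_reprK r).
by rewrite !quo_addE addbA.
Qed.
Fact quo_add0 : left_id (1 : quotient_type) quo_add.
Proof.
move=> p; rewrite -(quo_reprK p) [1](_ : _ = proj 0) //.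
by rewrite quo_addE add0b.
Qed.
Fact quo_addN : left_inverse (1 : quotient_type) quo_opp quo_add.
Proof. by move=> p; rewrite -(quo_reprK p) quo_oppE quo_addE addNb. Qed.
Fact quo_mulDr (p q r : quotient_type) :
  p * quo_add q r = quo_add (quo_add (p * q) (quo_opp p)) (p * r).
Proof.
rewrite /mul /= -(quo_reprK p) -(quo_reprK q) -(quo_reprK r).
by rewrite quo_oppE !(quo_addE, quo_mulE) mulbDr.
Qed.

HB.instance Definition _ := Group_isSkewBrace.Build quotient_type
  quo_addA quo_add0 quo_addN quo_mulDr.

Definition quotient : skewBraceType := quotient_type.

Lemma proj_morph : is_brace_morphism (proj : B -> quotient).
Proof.
by split=> a b; symmetry; [apply: quo_addE|apply: quo_mulE].
Qed.

End IdealTheory.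

Section Morphism.
Variables (B C : skewBraceType) (f : B -> C).
Hypothesis fM : is_brace_morphism f.

Lemma morph0 : f 0 = 0.
Proof.
by apply: (@addbI _ (f 0)); rewrite -(proj1 fM) !addb0.
Qed.
Lemma morphN a : f (- a) = - f a.
Proof. by apply: (@addbI _ (f a)); rewrite -(proj1 fM) !addbN morph0. Qed.
Lemma morphV a : f a^-1 = (f a)^-1.
Proof. by apply: (@mulgI _ (f a)); rewrite -(proj2 fM) !mulgV morph0. Qed.

Lemma preim_is_ideal (J : ideal C) : is_ideal (f @^-1` J).
Proof.
have [fD fMul] := fM.
have hA : is_subgroup (f @^-1` J : set (addg B)).
  split; first by rewrite /preimage /= morph0; apply: sub0.
    by move=> x y Jx Jy; rewrite /preimage /= fD; apply: subD.
  by move=> x Jx; rewrite /preimage /= morphN; apply: subN.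
have hM : is_subgroup (f @^-1` J).
  split; first by rewrite /preimage /= morph0; apply: sub0.
    by move=> x y Jx Jy; rewrite /preimage /= fMul; apply: subM.
  by move=> x Jx; rewrite /preimage /= morphV; apply: subV.
split=> //.
- split=> // x a Jx; rewrite /preimage /= !fD morphN.
  exact: ideal_addconj.
- split=> // x a Jx; rewrite /preimage /= /conjg !fMul morphV.
  exact: (@ideal_conj _ J).
- move=> a x Jx; rewrite /preimage /= /lambda fD morphN fMul.
  exact: ideal_lambda.
Qed.

Definition preim_ideal (J : ideal C) : ideal B := ideal_of_set (preim_is_ideal J).

End Morphism.

Definition Soc_set (B : skewBraceType) : set B :=
  [set a | forall b, a * b = a + b /\ a + b = b + a].

Definition zeta_set (B : skewBraceType) : set B :=
  [set a | forall b, [/\ a * b = b * a, b * a = a + b & a + b = b + a]].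

Section SocleCentre.
Variable B : skewBraceType.
Implicit Types a b x : B.

Let central a := forall b, a + b = b + a.

Fact Soc_setP a :
  Soc_set a <-> (forall b, lambda a b = b) /\ central a.
Proof.
split=> [h|[h1 h2] b]; last by rewrite mulb_lambda h1.
by split=> b; have [e1 e2] := h b; rewrite // /lambda e1 addKb.
Qed.

Fact central_lambda a x : central x -> central (lambda a x).
Proof. by move=> h b; rewrite -[b](lambdaK a) -!lambdaD h. Qed.

Fact conj_Soc a x : Soc_set x -> x ^ a = lambda a^-1 x.
Proof.
move=> /Soc_setP [h1 h2]; rewrite /conjg [x * a]mulb_lambda h1 mulbDr mulVg.
by rewrite addb0 mulb_lambda -(central_lambda a^-1 h2) addbK.
Qed.

Fact Soc_inv x : Soc_set x -> x^-1 = - x.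
Proof.
move=> /Soc_setP [x1 x2].
by apply: (@addbI _ x); rewrite addbN -(x1 x^-1) -mulb_lambda mulgV.
Qed.

Fact Soc_subgroup_mul : is_subgroup (@Soc_set B).
Proof.
split.
- by apply/Soc_setP; split=> b; [apply: lambda1|rewrite add0b addb0].
- move=> x y /Soc_setP [x1 x2] /Soc_setP [y1 y2]; apply/Soc_setP.
  split=> b; first by rewrite lambdaM y1 x1.
  by rewrite mulb_lambda x1 -addbA y2 addbA x2 -addbA.
- move=> x Sx; have [x1 x2] := (Soc_setP x).1 Sx; apply/Soc_setP.
  split=> b; first by rewrite -{2}(lambdaVK x b) x1.
  rewrite (Soc_inv Sx); apply: (@addbI _ x); rewrite addNKb.
  by rewrite addbA x2 addbK.
Qed.

Fact Soc_subgroup_add : is_subgroup (@Soc_set B : set (addg B)).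
Proof.
have [s1 sM sV] := Soc_subgroup_mul; split=> //.
- move=> x y Sx Sy; have [e _] := Sx y.
  by rewrite [_ * _](esym e); apply: sM.
- by move=> x Sx; rewrite [_^-1](esym (Soc_inv Sx)); apply: sV.
Qed.

Fact Soc_lambda a x : Soc_set x -> Soc_set (lambda a x).
Proof.
move=> Sx; have [x1 x2] := (Soc_setP x).1 Sx; apply/Soc_setP; split.
  move=> b; rewrite -[a]invgK -(conj_Soc a^-1 Sx) /conjg invgK.
  by rewrite !lambdaM x1 lambdaK.
exact: central_lambda.
Qed.

Lemma Soc_is_ideal : is_ideal (@Soc_set B).
Proof.
have hA := Soc_subgroup_add; have hM := Soc_subgroup_mul.
split=> //; [split=> // x a Sx|split=> // x a Sx|exact: Soc_lambda].
- have [_ x2] := (Soc_setP x).1 Sx.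
  by rewrite [_ ^ _](_ : _ = x) // /conjg [_ * a](x2 a : _ = _ :> B) mulKg.
- by rewrite conj_Soc //; apply: Soc_lambda.
Qed.

Fact zeta_setP a :
  zeta_set a <-> Soc_set a /\ forall b, a * b = b * a.
Proof.
split=> [h|[h1 h2] b]; last by have [e1 e2] := h1 b; split; rewrite // -h2.
split; last by move=> b; have [] := h b.
by move=> b; have [e1 e2 e3] := h b; split; rewrite // e1.
Qed.

Fact zeta_lambda a x : zeta_set x -> lambda a x = x.
Proof.
move=> h; have [_ e2 e3] := h a.
by rewrite /lambda e2 e3 addKb.
Qed.

Lemma zeta_is_ideal : is_ideal (@zeta_set B).
Proof.
have [[hA hM] [_ nA] [_ nM] _] := Soc_is_ideal.
have zM : is_subgroup (@zeta_set B).
  have [s1 sM sV] := hM; split.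
  - by apply/zeta_setP; split=> // b; rewrite mul1g mulg1.
  - move=> x y /zeta_setP [Sx cx] /zeta_setP [Sy cy]; apply/zeta_setP.
    by split=> [|b]; [apply: sM|rewrite -mulgA cy mulgA cx mulgA].
  - move=> x /zeta_setP [Sx cx]; apply/zeta_setP; split=> [|b]; first exact: sV.
    by apply: (@mulgI _ x); rewrite mulVKg mulgA cx mulgK.
have zA : is_subgroup (@zeta_set B : set (addg B)).
  have [s1 sM sV] := zM; split=> //.
  - move=> x y Sx Sy; have [e1 e2 _] := Sx y.
    by rewrite [_ * _](esym (etrans e1 e2)); apply: sM.
  - move=> x Sx; have [Sx' _] := (zeta_setP x).1 Sx.
    by rewrite [_^-1](esym (Soc_inv Sx')); apply: sV.
split=> //; [split=> // x a Sx|split=> // x a Sx|].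
- have [_ _ e] := Sx a.
  by rewrite [_ ^ _](_ : _ = x) // /conjg [_ * a](e : _ = _ :> B) mulKg.
- by have [e _ _] := Sx a; rewrite /conjg e mulKg.
- by move=> a x Sx; rewrite zeta_lambda.
Qed.

Lemma zero_is_ideal : is_ideal [set 0 : B].
Proof.
have hA : is_subgroup ([set 0 : B] : set (addg B)).
  by split=> // [x y -> ->|x ->]; [apply: (@mulg1 (addg B))|apply: (@invg1 (addg B))].
have hM : is_subgroup [set 0 : B].
  by split=> // [x y -> ->|x ->]; rewrite /= ?mulg1 ?invg1.
split=> //; [split=> // x g ->|split=> // x g ->|move=> a x ->].
- by apply: (@conj1g (addg B)).
- by rewrite /= conj1g.
- by rewrite /= lambda0.
Qed.

End SocleCentre.

Definition Soc (B : skewBraceType) : ideal B := ideal_of_set (Soc_is_ideal B).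
Definition zeta (B : skewBraceType) : ideal B := ideal_of_set (zeta_is_ideal B).
Definition zero_ideal (B : skewBraceType) : ideal B := ideal_of_set (zero_is_ideal B).

(* The ideal J containing I such that J / I = Soc (B / I), resp. zeta (B / I). *)
Definition Soc_above (B : skewBraceType) (I : ideal B) : ideal B :=
  preim_ideal (proj_morph I) (Soc (quotient I)).
Definition zeta_above (B : skewBraceType) (I : ideal B) : ideal B :=
  preim_ideal (proj_morph I) (zeta (quotient I)).

Fixpoint Soc_series (B : skewBraceType) (n : nat) : ideal B :=
  if n is m.+1 then Soc_above (Soc_series B m) else zero_ideal B.

Definition finite_multipermutational_level (A : skewBraceType) : Prop :=
  exists n, Soc_series A n = setT :> set A.

Definition finitely_generated (B : skewBraceType) (S : subbrace B) : Prop :=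
  exists X : set B, finite_set X /\ S = smallest (@is_subbrace B) X :> set B.

Definition locally_multipermutational (B : skewBraceType) : Prop :=
  forall S : subbrace B, finitely_generated S ->
    finite_multipermutational_level (subbrace_brace S).

Section Ordinals.
Variables (W : Type) (R : rel W).

Definition strictly_below (v w : W) : Prop := R v w /\ v <> w.
Definition is_zero (w : W) : Prop := forall v, ~ strictly_below v w.
Definition is_succ (v w : W) : Prop :=
  strictly_below v w /\ forall u, ~ (strictly_below v u /\ strictly_below u w).
Definition is_limit (w : W) : Prop :=
  ~ is_zero w /\ forall v, ~ is_succ v w.

End Ordinals.

(* Z w is the term of the central series whose index is the order type of the
   strict initial segment of w in the well-ordered type (W, R). *)
Definition is_central_series (B : skewBraceType) (W : Type) (R : rel W)
    (Z : W -> ideal B) : Prop :=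
  forall w,
    [/\ is_zero R w -> Z w = [set 0] :> set B,
        forall v, is_succ R v w -> Z w = zeta_above (Z v) :> set B
      & is_limit R w ->
        Z w = \bigcup_(v in [set v | strictly_below R v w]) Z v :> set B].

Definition hypercentral (B : skewBraceType) : Prop :=
  exists (W : Type) (R : rel W) (Z : W -> ideal B),
    [/\ well_order R, is_central_series R Z & exists w, Z w = setT :> set B].

Definition abelian_brace (A : skewBraceType) : Prop := zeta A = setT :> set A.

(* For ideals I `<=` J of B, this is the skew brace J / I. *)
Definition section_brace (B : skewBraceType) (J I : ideal B) : skewBraceType :=
  quotient (preim_ideal (incl_morph J) I).

Definition soluble_brace (B : skewBraceType) : Prop :=
  exists (n : nat) (I : nat -> ideal B),
    [/\ I 0%N = [set 0] :> set B, I n = setT :> set B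
      & forall j, (j < n)%N ->
          I j `<=` I j.+1 /\ abelian_brace (section_brace (I j.+1) (I j))].

Definition i_artinian (B : skewBraceType) : Prop :=
  forall I : nat -> ideal B, (forall n, I n.+1 `<=` I n) ->
    exists N, forall n, (N <= n)%N -> I n = I N :> set B.

Definition s_artinian (B : skewBraceType) : Prop :=
  forall S : nat -> subbrace B, (forall n, S n.+1 `<=` S n) ->
    exists N, forall n, (N <= n)%N -> S n = S N :> set B.

(* Main.v *)
(* In a two-sided skew brace the maps lambda_b, x |-> -b + x + b and
   x |-> b^-1 x b are automorphisms of the additive group; ideals are the
   additive subgroups they preserve and zeta is their set of common fixed
   points. On Soc the maps lambda_b - 1 multiply like the elements b under
   a * b = lambda_a b - b, which makes a two-sided multipermutational brace
   centrally nilpotent. Hence, if B is locally multipermutational and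
   i-artinian, its chief factors are central, and B is hypercentral. Grün's
   argument rules out nonzero ideals K = K', so the derived series reaches 0.
   For the minimal condition on subbraces it suffices that an additively
   commutative ideal A satisfies the minimal condition on additive subgroups:
   by the minimal condition on centralisers B acts through finitely many maps
   on the union U of the finite ideals inside A. A subgroup N of A maximal with
   respect to meeting the fixed points trivially has artinian quotient A / N,
   and its finitely many conjugates meet trivially inside U, so U is artinian;
   an element of A central modulo U would again lie in a finite ideal, so
   U = A. *)
Require Import Defs.
From HB Require Import structures.
From mathcomp Require Import all_boot all_algebra.
From mathcomp Require Import mathcomp_extra boolp classical_sets functions.
From mathcomp Require Import cardinality wochoice.

(* Again, since ssrbool has its own addbA, addbK, etc. *)
Import Defs.

Set Implicit Arguments.
Unset Strict Implicit.
Unset Printing Implicit Defensive.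

Import GRing.Theory.
Local Open Scope classical_set_scope.

(** * Descending chains of sets *)

Definition decreasing_chain (T : Type) (H : nat -> set T) : Prop :=
  forall n, H n.+1 `<=` H n.

Definition stationary (T : Type) (H : nat -> set T) : Prop :=
  exists N, forall n, (N <= n)%N -> H n = H N.

Definition dcc (T : Type) (P : set T -> Prop) : Prop :=
  forall H, (forall n, P (H n)) -> decreasing_chain H -> stationary H.

Section Chains.
Variable T : Type.
Implicit Types (H : nat -> set T) (P : set T -> Prop).

Lemma decreasing_chain_le H m n :
  decreasing_chain H -> (m <= n)%N -> H n `<=` H m.
Proof.
move=> dH /subnK <-; elim: (n - m)%N => // k IHk.
by apply: subset_trans IHk; rewrite addSn; apply: dH.
Qed.

Lemma dcc_sub P Q : (forall X, P X -> Q X) -> dcc Q -> dcc P.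
Proof. by move=> PQ dQ H PH; apply: dQ => n; apply: PQ. Qed.

(** Without a minimal member, repeatedly choosing a strictly smaller one would give a chain that
    never becomes stationary. *)
Lemma dcc_minimal P X0 : dcc P -> P X0 ->
  exists X, P X /\ forall Y, P Y -> Y `<=` X -> Y = X.
Proof.
move=> dP PX0; apply: contrapT => noX.
have step (X : {X | P X}) : exists Y : {X | P X},
    sval Y `<=` sval X /\ sval Y <> sval X.
  apply: contrapT => noY; apply: noX; exists (sval X); split; first exact: svalP.
  move=> Y PY YX; apply: contrapT => neq; apply: noY.
  by exists (exist _ Y PY).
have [f fP] := choice step.
pose H n := sval (iter n f (exist _ X0 PX0)).
have [||N HN] := dP H.
- by move=> n; apply: svalP.
- by move=> n; have [] := fP (iter n f (exist _ X0 PX0)).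
have [_] := fP (iter N f (exist _ X0 PX0)); apply.
exact: (HN N.+1 (leqnSn N)).
Qed.

(* Beyond the stage where the diagonal U k k is stationary all U k i agree;
   only finitely many rows k remain. *)
Lemma stationary_uniform (U : nat -> nat -> set T) :
    (forall k i, U k i.+1 `<=` U k i) -> (forall k i, U k.+1 i `<=` U k i) ->
    (forall k, stationary (U k)) -> stationary (fun k => U k k) ->
  exists N, forall k i, (N <= i)%N -> U k i = U k N.
Proof.
move=> dr dc sr [n0 sd].
have leU k k' i i' : (k <= k')%N -> (i <= i')%N -> U k' i' `<=` U k i.
  move=> lek lei; apply: (@subset_trans _ (U k i')).
    exact: (@decreasing_chain_le (fun k => U k i')).
  exact: (@decreasing_chain_le (U k)).
have [N0 sN0] : exists N, forall k, (k < n0)%N ->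
    forall i, (N <= i)%N -> U k i = U k N.
  elim: (n0) => [|m [N IHN]]; first by exists 0%N.
  have [N' sN'] := sr m; exists (maxn N N') => k; rewrite ltnS leq_eqVlt.
  have aux j M : (forall i, (M <= i)%N -> U j i = U j M) -> (M <= maxn N N')%N ->
      forall i, (maxn N N' <= i)%N -> U j i = U j (maxn N N').
    by move=> sM leM i lei; rewrite !sM // (leq_trans leM).
  case/orP=> [/eqP->|ltk]; first by apply: aux sN' _; apply: leq_maxr.
  by apply: aux (IHN k ltk) _; apply: leq_maxl.
have cst k i : (n0 <= k)%N -> (n0 <= i)%N -> U k i = U n0 n0.
  move=> lek lei; apply/seteqP; split; first exact: leU.
  rewrite -(sd (maxn k i)); last by rewrite leq_max lek.
  by apply: leU; [apply: leq_maxl|apply: leq_maxr].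
exists (maxn n0 N0) => k i; rewrite geq_max => /andP[le0 leN].
case: (ltnP k n0) => [ltk|lek]; last by rewrite !cst // leq_maxl.
by rewrite !(sN0 k ltk) // leq_maxr.
Qed.

End Chains.

(** * Abelian groups with the descending chain condition *)

Section AbelianGroups.
Local Open Scope ring_scope.
Variable V : zmodType.
Implicit Types (H N S : set V) (x y : V).

Definition zsub H : Prop := H 0 /\ forall x y, H x -> H y -> H (x - y).

Lemma zsub0 H : zsub H -> H 0. Proof. by case. Qed.
Lemma zsubB H x y : zsub H -> H x -> H y -> H (x - y).
Proof. by case=> _; apply. Qed.
Lemma zsubN H x : zsub H -> H x -> H (- x).
Proof. by move=> sH Hx; rewrite -sub0r; apply: zsubB => //; apply: zsub0. Qed.
Lemma zsubD H x y : zsub H -> H x -> H y -> H (x + y).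
Proof. by move=> sH Hx Hy; rewrite -[y]opprK; apply: zsubB => //; apply: zsubN. Qed.
Lemma zsubMn H x n : zsub H -> H x -> H (x *+ n).
Proof.
move=> sH Hx; elim: n => [|n IHn]; first by rewrite mulr0n; apply: zsub0.
by rewrite mulrS; apply: zsubD.
Qed.
Lemma zsubMz H x (n : int) : zsub H -> H x -> H (x *~ n).
Proof.
move=> sH Hx; case: n => n; first exact: zsubMn.
by rewrite NegzE mulrNz; apply: zsubN => //; apply: zsubMn.
Qed.

Lemma zsubI H N : zsub H -> zsub N -> zsub (H `&` N).
Proof.
by move=> sH sN; split=> [|x y [Hx Nx] [Hy Ny]]; split;
   [apply: zsub0|apply: zsub0|apply: zsubB|apply: zsubB].
Qed.

Definition zadd H N : set V := [set x + y | x in H & y in N].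

Lemma zadd_zsub H N : zsub H -> zsub N -> zsub (zadd H N).
Proof.
move=> sH sN; split.
  by exists 0; [exact: zsub0|exists 0; [exact: zsub0|rewrite addr0]].
move=> _ _ [x1 Hx1 [y1 Ny1 <-]] [x2 Hx2 [y2 Ny2 <-]].
exists (x1 - x2); first exact: zsubB.
by exists (y1 - y2); [exact: zsubB|rewrite opprD addrACA].
Qed.

Lemma zaddl H N : zsub N -> H `<=` zadd H N.
Proof. by move=> sN x Hx; exists x => //; exists 0; rewrite ?addr0 //; apply: zsub0. Qed.
Lemma zaddr H N : zsub H -> N `<=` zadd H N.
Proof. by move=> sH x Nx; exists 0; [apply: zsub0|exists x; rewrite ?add0r]. Qed.

Definition zcyc x : set V := [set x *~ n | n in [set: int]].

Lemma zcyc_zsub x : zsub (zcyc x).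
Proof.
split; first by exists 0.
by move=> _ _ [m _ <-] [n _ <-]; exists (m - n) => //; rewrite mulrzBr.
Qed.

Lemma zcyc_id x : zcyc x x. Proof. by exists 1. Qed.

(** Modular law: nested subgroups with the same sum with [N] and the same intersection with [N] are
    equal. *)
Lemma stationary_modular (H : nat -> set V) N : zsub N ->
    (forall n, zsub (H n)) -> decreasing_chain H ->
    stationary (fun n => zadd (H n) N) -> stationary (fun n => H n `&` N) ->
  stationary H.
Proof.
move=> sN sH dH [m1 s1] [m2 s2].
exists (maxn m1 m2) => n; rewrite geq_max => /andP[le1 le2].
have le1' := leq_maxl m1 m2; have le2' := leq_maxr m1 m2.
set M := maxn m1 m2 in le1' le2' *.
have lenM : H (maxn n M) `<=` H n by apply: decreasing_chain_le (leq_maxl _ _).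
have leMM : H (maxn n M) `<=` H M by apply: decreasing_chain_le (leq_maxr _ _).
have main k : (m1 <= k)%N -> (m2 <= k)%N -> H (maxn n M) `<=` H k ->
    H k `<=` H (maxn n M).
  move=> lek1 lek2 sub x Hx.
  have : zadd (H (maxn n M)) N x.
    rewrite (s1 _ (leq_trans le1 (leq_maxl _ _))) -(s1 k lek1).
    exact: zaddl.
  case=> h Hh [y Ny def_x].
  suff: (H (maxn n M) `&` N) y by case=> Hy _; rewrite -def_x; apply: zsubD.
  rewrite s2 ?(leq_trans le2 (leq_maxl _ _)) // -(s2 k lek2); split=> //.
  have -> : y = x - h by rewrite -def_x addrC addKr.
  by apply: zsubB => //; apply: sub.
by apply/seteqP; split; apply: (@subset_trans _ (H (maxn n M))) => //; apply: main.
Qed.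

(* The descending chain condition for V / N, stated without forming the
   quotient. *)
Definition codcc N : Prop :=
  forall H : nat -> set V, (forall n, zsub (H n)) -> decreasing_chain H ->
    stationary (fun n => H n `&` N) -> stationary H.

(** The quotient by the intersection embeds in the product of both quotients: [N'] settles the chain
    cut with [N], then [N] settles the chain itself. *)
Lemma codccI N N' : zsub N -> codcc N -> codcc N' -> codcc (N `&` N').
Proof.
move=> sN cN cN' H sH dH s; apply: cN => //; apply: cN'.
- by move=> n; apply: zsubI.
- by move=> n; apply: setSI.
- by under eq_fun do rewrite -setIA.
Qed.

Lemma codcc_preim N (g : V -> V) : injective g ->
  {morph g : x y / x - y} -> codcc N -> codcc (g @^-1` N).
Proof.
move=> gI gB cN H sH dH [m s].
have g0 : g 0 = 0 by move: (gB 0 0); rewrite !subrr.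
have [|||M sM] := cN (fun n => g @` H n).
- move=> n; split; first by exists 0 => //; apply: zsub0.
  by move=> _ _ [x Hx <-] [y Hy <-]; exists (x - y); [apply: zsubB|].
- by move=> n; apply: image_subset.
- exists m => n lemn; apply/seteqP.
  split=> _ [[x Hx <-] Ngx]; split=> //; exists x => //.
    by have : (H n `&` g @^-1` N) x by []; rewrite s // => -[].
  by have : (H m `&` g @^-1` N) x by []; rewrite -(s n) // => -[].
exists M => n leMn; apply/seteqP; split=> x Hx.
  have : (g @` H n) (g x) by exists x.
  by rewrite sM // => -[y Hy /gI <-].
have : (g @` H M) (g x) by exists x.
by rewrite -(sM n) // => -[y Hy /gI <-].
Qed.

Lemma dcc_codcc N : zsub N ->
  dcc (fun H => zsub H /\ N `<=` H) -> codcc N.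
Proof.
move=> sN dN H sH dH s; apply: (stationary_modular sN) => //; apply: dN.
  by move=> n; split; [apply: zadd_zsub|apply: zaddr].
by move=> n _ [x Hx [y Ny <-]]; exists x; [apply: dH|exists y].
Qed.

Lemma zsub_abszMn H x (k : int) : zsub H -> H (x *~ k) -> H (x *+ `|k|%N).
Proof.
by move=> sH; case: k => k //=; rewrite NegzE mulrNz => /(zsubN sH); rewrite opprK.
Qed.

Lemma zsub_coprime H m n x :
  zsub H -> coprime m n -> H (x *+ m) -> H (x *+ n) -> H x.
Proof.
move=> sH co Hm Hn; have [u [v e]] := Bezoutz m%:Z n%:Z.
have {}e : u * m%:Z + v * n%:Z = 1 by rewrite e /gcdz (eqP co).
rewrite -[x]mulr1z -e mulrzDr; apply: zsubD => //.
  by rewrite [u * _]mulrC mulrzA; apply: zsubMz.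
by rewrite [v * _]mulrC mulrzA; apply: zsubMz.
Qed.

(* N is maximal among the subgroups of W meeting S trivially: the second clause
   says that S embeds as an essential subgroup of W / N. *)
Definition max_avoid W S N : Prop :=
  [/\ zsub N, N `<=` W, forall x, N x -> S x -> x = 0
    & forall y, W y -> ~ N y ->
        exists2 a, N a & exists k : int, S (a + y *~ k) /\ a + y *~ k <> 0].

Lemma exists_max_avoid W S : zsub W -> exists N, max_avoid W S N.
Proof.
move=> sW.
pose P X := X = set0 \/ [/\ zsub X, X `<=` W & forall x, X x -> S x -> x = 0].
have P0 : P [set 0].
  right; split=> [|x ->|x ->] //; last exact: zsub0.
  by split=> // x y -> ->; rewrite subrr.
have [|N [[N0|[sN NW NS]] maxN]] := @Zorn_bigcup _ P.
- move=> F FP totF.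
  have [[X FX X0]|noX] := pselect (exists2 X, F X & X !=set0); last first.
    left; apply/eqP/negPn/negP => /set0P[x [X FX Xx]].
    by apply: noX; exists X => //; exists x.
  have PX Y y : F Y -> Y y ->
      [/\ zsub Y, Y `<=` W & forall x, Y x -> S x -> x = 0].
    by move=> FY Yy; have [Y0|//] := FP _ FY; rewrite Y0 in Yy.
  right; split.
  - split.
      by case: X0 => x Xx; exists X => //; apply: zsub0; case: (PX _ _ FX Xx).
    move=> x y [Y FY Yx] [Z FZ Zy].
    have [YZ|ZY] := totF _ _ FY FZ.
      by exists Z => //; apply: zsubB => //; [case: (PX _ _ FZ Zy)|apply: YZ].
    by exists Y => //; apply: zsubB => //; [case: (PX _ _ FY Yx)|apply: ZY].
  - by move=> x [Y FY Yx]; have [_ YW _] := PX _ _ FY Yx; apply: YW.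
  - by move=> x [Y FY Yx]; have [_ _ YS] := PX _ _ FY Yx; apply: YS.
- case: (maxN [set 0]) => //; rewrite N0; split=> // sub; exact: (sub 0).
exists N; split=> // y Wy Ny; apply: contrapT => no.
apply: (maxN (zadd N (zcyc y))).
  split; first exact/zaddl/zcyc_zsub.
  by move=> sub; apply/Ny/sub; apply: zaddr => //; apply: zcyc_id.
right; split; first by apply: zadd_zsub => //; apply: zcyc_zsub.
  by move=> _ [x Nx [_ [k _ <-] <-]]; apply: zsubD; [|exact: NW|exact: zsubMz].
move=> _ [x Nx [_ [k _ <-] <-]] Sz; apply: contrapT => nz.
by apply: no; exists x => //; exists k.
Qed.

(** If [p] divided [k] in the essential element [a + y *~ k], that element would lie in both [N] and
    [S] and so vanish. Hence [p] and [k] are coprime, and as both multiples of [y] lie in [N + S],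
    so does [y]. *)
Lemma max_avoid_prime W S N p y : zsub S -> max_avoid W S N -> prime p ->
  W y -> N (y *+ p) -> zadd N S y.
Proof.
move=> sS [sN NW NS essN] pr_p Wy Npy.
have [Ny|nNy] := pselect (N y); first exact: zaddl.
have [a Na [k [Sk nz]]] := essN y Wy nNy.
have sNS := zadd_zsub sN sS.
have co : coprime p `|k|.
  rewrite prime_coprime //; apply/negP => /dvdnP[q eq_k]; apply: nz.
  apply: NS => //; apply: zsubD => //.
  have -> : k = (-1) ^+ (k < 0)%R * (p * q)%:Z by rewrite mulnC -eq_k -intEsign.
  rewrite mulrC mulrzA; apply: zsubMz => //.
  by rewrite -[_ *~ _]/(y *+ (p * q)) mulrnA; apply: zsubMn.
apply: (zsub_coprime sNS co); first exact: zaddl.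
apply: zsub_abszMn => //.
have -> : y *~ k = (a + y *~ k) - a by rewrite addrC addKr.
by apply: zsubB => //; [apply: zaddr|apply: zaddl].
Qed.

(** The subgroups [N + <2^k x>] become stationary, which gives [2^m x = a + 2^(m+1) c x] with [a] in
    [N]. So [2^m (1 - 2c)] sends [x] into [N], and it is nonzero because [1 - 2c] is odd. *)
Lemma dcc_torsion H N x : zsub H -> zsub N -> N `<=` H ->
    dcc (fun K => zsub K /\ N `<=` K /\ K `<=` H) -> H x ->
  exists2 n, (0 < n)%N & N (x *+ n).
Proof.
move=> sH sN NH dH Hx.
have sc k := zcyc_zsub (x *+ (2 ^ k)%N).
have [||m st] := dH (fun k => zadd N (zcyc (x *+ (2 ^ k)%N))).
- move=> k; split; first exact: zadd_zsub.
  split; first exact: zaddl.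
  move=> _ [a Na [_ [c _ <-] <-]]; apply: zsubD => //; first exact: NH.
  by apply: zsubMz => //; apply: zsubMn.
- move=> k _ [a Na [_ [c _ <-] <-]]; exists a => //.
  exists (x *+ (2 ^ k.+1)%N *~ c) => //; exists (2 * c) => //.
  by rewrite expnSr mulrnA !pmulrn -!mulrzA mulrA.
have : zadd N (zcyc (x *+ (2 ^ m)%N)) (x *+ (2 ^ m)%N).
  by apply: zaddr => //; apply: zcyc_id.
rewrite -(st m.+1 (leqnSn m)) => -[a Na [_ [c _ <-] e]].
pose d : int := (2 ^ m)%N%:Z * (1 - 2 * c).
exists `|d|%N.
  rewrite absz_gt0 mulf_neq0 //; first by rewrite eqz_nat -lt0n expn_gt0.
  by apply/eqP => /eqP; rewrite subr_eq0 => /eqP/(congr1 (modz^~ 2)); rewrite mulrC modzMl.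
apply: zsub_abszMn => //.
rewrite /d mulrzA mulrzBr mulr1z -[x *~ (2 ^ m)%N]pmulrn -{1}e expnSr.
by rewrite mulrnA [X in X *~ c]pmulrn -mulrzA addrK.
Qed.

Lemma dcc_primes S : zsub S -> dcc (fun K => zsub K /\ K `<=` S) ->
  exists k, forall p s, prime p -> S s -> s *+ p = 0 -> s <> 0 -> (p <= k)%N.
Proof.
move=> sS dS.
(* [T k] consists of the elements killed by a positive integer without prime factors up to [k]. An
   element of prime order [p > k] lies in [T k]; once [T k = T p], an integer prime to [p] kills it
   too. *)
pose T k : set V := [set s | S s /\ exists2 m, (0 < m)%N &
   (forall p, prime p -> (p <= k)%N -> ~~ (p %| m)%N) /\ s *+ m = 0].
have [||k st] := dS T.
- move=> k; split; last by move=> s [].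
  split.
    split; first exact: zsub0.
    by exists 1%N => //; split=> // p pr_p _; rewrite dvdn1; case: p pr_p => [|[]].
  move=> x y [Sx [m m0 [pm xm]]] [Sy [n n0 [pn yn]]]; split; first exact: zsubB.
  exists (m * n)%N; first by rewrite muln_gt0 m0.
  split=> [p pr_p le|]; first by rewrite Euclid_dvdM // negb_or pm ?pn.
  by rewrite mulrnBl mulrnA xm mul0rn mulnC mulrnA yn mul0rn subrr.
- move=> k s [Ss [m m0 [pm sm]]]; split=> //; exists m => //; split=> // p pr_p le.
  by apply: pm => //; apply: leqW.
exists k => p s pr_p Ss sp nz; rewrite leqNgt; apply/negP => ltkp; apply: nz.
have : T k s.
  split=> //; exists p; first exact: prime_gt0.
  split=> // q pr_q leq; rewrite dvdn_prime2 //; apply/eqP => eq_qp.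
  by rewrite eq_qp leqNgt ltkp in leq.
rewrite -(st p (ltnW ltkp)) => -[_ [m _ [pm sm]]].
have s0 : zsub [set (0 : V)] by split=> // x y -> ->; rewrite subrr.
apply: (@zsub_coprime [set 0] p m) => //.
by rewrite prime_coprime //; apply: pm.
Qed.

Lemma max_avoid_prod S N (ps : seq nat) x : zsub S -> max_avoid setT S N ->
  uniq ps -> all prime ps -> N (x *+ \prod_(p <- ps) p) -> zadd N S x.
Proof.
move=> sS mN; have [sN _ _ _] := mN.
elim: ps x => [|p ps IH] x /=; first by rewrite big_nil => _ _ Nx; apply: zaddl.
move=> /andP[pps ups] /andP[pr_p prps]; rewrite big_cons => Nx.
have co : coprime p (\prod_(q <- ps) q).
  elim: (ps) pps prps => [|q qs IHq]; first by rewrite big_nil coprimen1.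
  rewrite inE negb_or big_cons /= => /andP[npq nq] /andP[pr_q prqs].
  by rewrite coprimeMr IHq // prime_coprime // dvdn_prime2 // npq.
apply: (zsub_coprime _ co); first exact: zadd_zsub.
  by apply: IH => //; rewrite -mulrnA.
by apply: (max_avoid_prime _ mN pr_p) => //; rewrite -mulrnA mulnC.
Qed.

(* An essential extension V / N of a group S with the descending chain
   condition is M-primary for some squarefree M and its M-torsion lies in S; a
   subgroup is then determined by the M-torsion of its multiples by powers
   of M. *)
Lemma codcc_max_avoid S N : zsub S -> dcc (fun K => zsub K /\ K `<=` S) ->
  max_avoid setT S N -> codcc N.
Proof.
move=> sS dS mN; have [sN _ NS essN] := mN.
have s0 : zsub [set (0 : V)] by split=> // x y -> ->; rewrite subrr.
have [k0 bnd] := dcc_primes sS dS.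
pose ps := [seq p <- iota 0 k0.+1 | prime p]; pose M := \prod_(p <- ps) p.
have pM p : prime p -> (p <= k0)%N -> (p %| M)%N.
  move=> pr_p le; have ips : p \in ps by rewrite mem_filter pr_p mem_iota /= ltnS.
  by rewrite /M (big_rem p) //= dvdn_mulr.
have NM x : N (x *+ M) -> zadd N S x.
  apply: max_avoid_prod => //; first by rewrite filter_uniq // iota_uniq.
  exact: filter_all.
(* Essentiality puts [a + x *~ k] into [S] for some nonzero [k], and the chain condition makes [S]
   torsion. *)
have tors x : exists2 n, (0 < n)%N & N (x *+ n).
  have [Nx|nNx] := pselect (N x); first by exists 1%N.
  have [a Na [k [Sk nz]]] := essN x Logic.I nNx.
  have k_nz : k != 0.
    apply/eqP => k0'; apply: nz; move: Sk; rewrite k0' mulr0z addr0; exact: NS.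
  have S0 : [set 0] `<=` S by move=> _ ->; apply: zsub0.
  have dS0 : dcc (fun K => zsub K /\ [set 0] `<=` K /\ K `<=` S).
    by apply: dcc_sub dS => K [sK [_ KS]].
  have [n n0 /= en] := dcc_torsion sS s0 S0 dS0 Sk.
  exists (`|k| * n)%N; first by rewrite muln_gt0 absz_gt0 k_nz.
  rewrite -[(_ * n)%N]/(`|(`|k| * n)%N%:Z|%N).
  have -> : (`|k| * n)%N%:Z = (-1) ^+ (k < 0)%R * (k * n%:Z).
    by rewrite PoszM {3}[k]intEsign !mulrA -signr_addb addbb mul1r.
  apply: zsub_abszMn => //; rewrite mulrC mulrzA; apply: zsubMz => //.
  rewrite mulrzA; have -> : x *~ k *~ n%:Z = - (a *+ n).
    by apply/eqP; rewrite -addr_eq0 addrC -[X in _ + X]/(x *~ k *+ n) -mulrnDl en.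
  by apply: zsubN => //; apply: zsubMn.
(* Induction on a multiplier [n]: with [p] its least prime factor, either [n / p] already suffices
   or [p] is the order of a nonzero element of [S] and therefore divides [M]. *)
have primary x : exists k, N (x *+ (M ^ k)%N).
  have [n n0] := tors x; elim/ltn_ind: n n0 x => n IH n0 x Nx.
  have [n1|n_gt1] := leqP n 1.
    have {}n1 : n = 1%N by apply/eqP; rewrite eqn_leq n1.
    by exists 0%N; rewrite n1 in Nx.
  have pr_p := pdiv_prime n_gt1; have /dvdnP[m def_n] := pdiv_dvd n.
  set p := pdiv n in pr_p def_n.
  have m0 : (0 < m)%N by move: n0; rewrite def_n muln_gt0 => /andP[].
  have ltmn : (m < n)%N by rewrite def_n ltn_Pmulr // prime_gt1.
  have [Nm|nNm] := pselect (N (x *+ m)); first exact: IH Nm.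
  have Npm : N (x *+ m *+ p) by rewrite -mulrnA -def_n.
  have [a Na [s Ss e]] := max_avoid_prime sS mN pr_p Logic.I Npm.
  have pk0 : (p <= k0)%N.
    apply: (bnd p s) => //; last by move=> s0'; apply: nNm; rewrite -e s0' addr0.
    apply: NS; last exact: zsubMn.
    have -> : s = x *+ m - a by rewrite -e addrC addKr.
    by rewrite mulrnBl; apply: zsubB => //; apply: zsubMn.
  have [|j Nj] := IH m ltmn m0 (x *+ p); first by rewrite -mulrnA mulnC -def_n.
  exists j.+1; have /dvdnP[q eM] := pM p pr_p pk0.
  have -> : (M ^ j.+1 = p * M ^ j * q)%N.
    by rewrite expnS {1}eM mulnC -!mulnA mulnC [(q * p)%N]mulnC mulnA mulnAC.
  by rewrite mulrnA; apply: zsubMn => //; rewrite mulrnA.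
pose Mt : set V := [set x | N (x *+ M)].
(* Modulo [N], this is the [M]-torsion of the multiple of [H] by [M^k]. It shrinks with [H] and with
   growing [k], as [stationary_uniform] requires. *)
pose U H k : set V := [set y | N (y *+ M) /\ exists2 h, H h & N (y - h *+ (M ^ k)%N)].
have zU H k : zsub H -> zsub (U H k).
  move=> sH; split.
    by split; rewrite ?mul0rn; [apply: zsub0|exists 0; rewrite ?mul0rn ?subrr; apply: zsub0].
  move=> x y [Nx [h Hh Nh]] [Ny [h' Hh' Nh']]; split.
    by rewrite mulrnBl; apply: zsubB.
  exists (h - h'); first exact: zsubB.
  have -> : x - y - (h - h') *+ (M ^ k)%N = (x - h *+ (M ^ k)%N) - (y - h' *+ (M ^ k)%N).
    by rewrite mulrnBl !opprD !opprK addrACA.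
  exact: zsubB.
apply: dcc_codcc => // H sH dH.
have zH n : zsub (H n) by have [] := sH n.
have NH n : N `<=` H n by have [] := sH n.
(* Since [Mt] lies in [N + S], a subgroup between [N] and [Mt] is determined by its intersection
   with [S]. *)
have dU (K : nat -> set V) : (forall n, zsub (K n)) -> (forall n, N `<=` K n) ->
    (forall n, K n `<=` Mt) -> decreasing_chain K -> stationary K.
  move=> zK NK KM dK; have [||m st] := dS (fun n => K n `&` S).
  - by move=> n; split=> [|x []//]; apply: zsubI.
  - by move=> n; apply: setSI.
  exists m => n le; apply/seteqP.
  have aux i j : K i `&` S = K j `&` S -> K i `<=` K j.
    move=> e x Kx; have [a Na [s Ss ex]] := NM x (KM i x Kx).
    have Ks : (K i `&` S) s.
      split=> //; have -> : s = x - a by rewrite -ex addrC addKr.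
      by apply: zsubB => //; apply: NK.
    rewrite -ex; apply: zsubD => //; first exact: NK.
    by move: Ks; rewrite e => -[].
  by split; apply: aux; rewrite st.
have NU k i : N `<=` U (H i) k.
  move=> x Nx; split; first exact: zsubMn.
  by exists 0; rewrite ?mul0rn ?subr0 //; apply: zsub0.
have [||||m st] := @stationary_uniform _ (fun k i => U (H i) k).
- by move=> k i x [Nx [h Hh e]]; split=> //; exists h => //; apply: dH.
- move=> k i x [Nx [h Hh e]]; split=> //; exists (h *+ M); first exact: zsubMn.
  by rewrite -mulrnA -expnS.
- move=> k; apply: dU => [n|n|n x []//|n x [Nx [h Hh e]]] //; first exact: zU.
  by split=> //; exists h => //; apply: dH.
- apply: dU => [n|n|n x []//|n x [Nx [h Hh e]]] //; first exact: zU.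
  split=> //; exists (h *+ M); first by apply: zsubMn => //; apply: dH.
  by rewrite -mulrnA -expnS.
exists m => n le; apply/seteqP; split; first exact: decreasing_chain_le.
move=> x Hx; have [k] := primary x.
elim: k x Hx => [|k IH] x Hx Nx; first exact: NH.
(* Modulo [N], [M^k x] equals [M^k h] for some [h] in the smaller [H n], so [x - h] is killed by a
   lower power of [M] than [x]. *)
have : U (H m) k (x *+ (M ^ k)%N).
  split; first by rewrite -mulrnA -expnSr.
  by exists x; rewrite ?subrr //; apply: zsub0.
rewrite -(st k n le) => -[_ [h Hh]]; rewrite -mulrnBl => Nxh.
have Hmh : H m h by apply: decreasing_chain_le Hh.
have := IH (x - h) (zsubB (zH m) Hx Hmh) Nxh.
by move=> /zsubD/(_ Hh); rewrite subrK; apply.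
Qed.

(** [H] is covered by the sums of one chosen preimage per value and an element of the kernel. *)
Lemma finite_set_additive H (f : V -> V) : {morph f : x y / x - y} -> zsub H ->
  finite_set (H `&` f @^-1` [set 0]) -> finite_set (f @` H) -> finite_set H.
Proof.
move=> fB sH fK fI.
have /choice[r rP] : forall y, exists x, (f @` H) y -> H x /\ f x = y.
  move=> y; have [[x Hx <-]|no] := pselect ((f @` H) y); first by exists x.
  by exists 0.
apply: sub_finite_set
  (finite_image2 (fun y k => r y + k) fI fK) => x Hx.
have [|Hr fr] := rP (f x); first by exists x.
exists (f x); first by exists x.
exists (x - r (f x)); last by rewrite addrC subrK.
by split; [apply: zsubB|rewrite /= fB fr subrr].
Qed.

Lemma morphB_mulrn n : {morph (fun x : V => x *+ n) : x y / x - y}.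
Proof. by move=> x y; rewrite mulrnBl. Qed.

Lemma zsub_image H (f : V -> V) :
  {morph f : x y / x - y} -> zsub H -> zsub (f @` H).
Proof.
move=> fB sH; split.
  by exists 0; [apply: zsub0|move: (fB 0 0); rewrite !subrr].
by move=> _ _ [x Hx <-] [y Hy <-]; exists (x - y); [apply: zsubB|].
Qed.

Lemma finite_zcyc n x : (0 < n)%N -> x *+ n = 0 -> finite_set (zcyc x).
Proof.
move=> n0 xn; apply: sub_finite_set (finite_image (fun i => x *+ i) (finite_II n)).
move=> _ [k _ <-]; have nz : n%:Z != 0 by rewrite eqz_nat -lt0n.
have kn0 := modz_ge0 k nz; exists `|(k %% n)%Z|%N.
  by rewrite /= -ltz_nat gez0_abs // ltz_pmod.
rewrite {2}(divz_eq k n) mulrzDr [_ * n%:Z]mulrC mulrzA.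
by rewrite -[x *~ n]pmulrn xn mul0rz add0r pmulrn gez0_abs.
Qed.

(* In a minimal infinite subgroup, multiplication by some prime p has finite
   image, so p = 0; a subgroup maximal with respect to avoiding a cyclic
   subgroup is then of finite index. *)
Lemma dcc_exponent_finite W n : zsub W -> dcc (fun K => zsub K /\ K `<=` W) ->
  (0 < n)%N -> (forall x, W x -> x *+ n = 0) -> finite_set W.
Proof.
move=> sW dW n0 Wn; apply: contrapT => infW.
have [||H [[sH [HW infH]] minH]] :=
  @dcc_minimal _ (fun K => zsub K /\ K `<=` W /\ ~ finite_set K) W.
- by apply: dcc_sub dW => K [sK [KW _]].
- by split=> //; split.
have minH' K : zsub K -> K `<=` H -> K <> H -> finite_set K.
  move=> sK KH neq; apply: contrapT => infK; apply: neq; apply: minH => //.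
  by split=> //; split=> //; apply: subset_trans HW.
(* A least [d] with [d H] finite exists because [n H = 0]. For a prime factor [p] of it, minimality
   forces [(d / p) H = H], so [p H = d H] is finite; a proper kernel would be finite too, hence
   [p H = 0]. *)
pose fin d := `[< (0 < d)%N /\ finite_set ((fun x => x *+ d) @` H) >].
have exd : exists d, fin d.
  exists n; apply/asboolP; split=> //; apply: sub_finite_set (finite_set1 0).
  by move=> _ [x Hx <-]; apply: Wn; apply: HW.
have [d /asboolP[d0 find] mind] := ex_minnP exd.
have d_gt1 : (1 < d)%N.
  rewrite ltn_neqAle d0 andbT; apply/eqP => d1; apply: infH.
  by apply: sub_finite_set find => x Hx; exists x; rewrite // -d1.
have pr_p := pdiv_prime d_gt1; have /dvdnP[e def_d] := pdiv_dvd d.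
set p := pdiv d in pr_p def_d.
have e0 : (0 < e)%N by move: d0; rewrite def_d muln_gt0 => /andP[].
have eH : (fun x => x *+ e) @` H = H.
  apply: contrapT => neq.
  have /mind : fin e.
    apply/asboolP; split=> //; apply: minH' => //.
      by apply: zsub_image => //; apply: morphB_mulrn.
    by move=> _ [x Hx <-]; apply: zsubMn.
  by rewrite leqNgt def_d ltn_Pmulr // prime_gt1.
have pH x : H x -> x *+ p = 0.
  have finp : finite_set ((fun x => x *+ p) @` H).
    apply: sub_finite_set find => _ [z Hz <-].
    by move: Hz; rewrite -{1}eH => -[y Hy <-]; exists y; rewrite // def_d mulrnA.
  move=> Hx; have [] : (H `&` (fun x => x *+ p) @^-1` [set 0]) x; last by [].
  suff -> : H `&` (fun x => x *+ p) @^-1` [set 0] = H by [].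
  apply: contrapT => neq; apply: infH.
  apply: (finite_set_additive (@morphB_mulrn p)) => //; apply: minH' => //.
  split; first by split; [apply: zsub0|rewrite /= mul0rn].
  move=> z y [Hz pz] [Hy py]; split; first exact: zsubB.
  by rewrite /= mulrnBl pz py subrr.
have [x [Hx x0]] : exists x, H x /\ x <> 0.
  apply: contrapT => no; apply: infH; apply: sub_finite_set (finite_set1 0).
  by move=> x Hx; apply: contrapT => x0; apply: no; exists x.
have [N mN] := exists_max_avoid (zcyc x) sH; have [sN NH NS _] := mN.
(* [N] misses [x], so it is proper in [H] and thus finite; as [p H = 0], all of [H] lies in
   [N + <x>]. *)
have fN : finite_set N.
  apply: minH' => // eN; apply: x0; apply: NS; first by rewrite eN.
  exact: zcyc_id.
have fx := finite_zcyc (prime_gt0 pr_p) (pH x Hx).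
apply: infH; apply: sub_finite_set (finite_image2 (fun a s => a + s) fN fx) => y Hy.
by apply: (max_avoid_prime (zcyc_zsub x) mN pr_p) => //; rewrite pH //; apply: zsub0.
Qed.

End AbelianGroups.

(** * Abelian groups with operators *)

Section OperatorGroups.
Local Open Scope ring_scope.
Variables (V : zmodType) (O : Type) (act : O -> V -> V).
Hypothesis opactB : forall o, {morph act o : x y / x - y}.
Implicit Types (H K L U X : set V) (x y : V) (o : O).

Definition zinv H : Prop := zsub H /\ forall o x, H x -> H (act o x).

Hypothesis dcc_zinv : dcc zinv.
Hypothesis central_factor : forall K L, zinv K -> zinv L -> ~ L `<=` K ->
  exists x, [/\ L x, ~ K x & forall o, K (act o x - x)].
(* On a union of finite submodules the operators generate a finite set of
   maps. *)
Hypothesis finite_action : forall U, zinv U ->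
    (forall x, U x -> exists X, [/\ zinv X, finite_set X, X `<=` U & X x]) ->
  exists G : set (V -> V),
    [/\ finite_set G,
        forall g, G g -> injective g /\ {morph g : x y / x - y},
        forall o g, G g ->
          exists2 g', G g' & forall x, U x -> g (act o x) = g' x
      & exists2 g, G g & forall x, U x -> g x = x].

Lemma zinv_zsub H : zinv H -> zsub H. Proof. by case. Qed.

Lemma opact0 o : act o 0 = 0.
Proof. by move: (opactB o 0 0); rewrite !subrr. Qed.
Lemma opactN o x : act o (- x) = - act o x.
Proof. by rewrite -[- x]sub0r opactB opact0 sub0r. Qed.
Lemma opactD o x y : act o (x + y) = act o x + act o y.
Proof. by rewrite -[y in LHS]opprK opactB opactN opprK. Qed.
Lemma opactMn o x n : act o (x *+ n) = act o x *+ n.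
Proof. by elim: n => [|n IHn]; rewrite ?mulr0n ?opact0 // !mulrS opactD IHn. Qed.

Lemma zinv0 : zinv [set 0].
Proof.
split=> [|o x ->]; last by rewrite /= opact0.
by split=> // x y -> ->; rewrite subrr.
Qed.

Lemma zinv_zadd H K : zinv H -> zinv K -> zinv (zadd H K).
Proof.
move=> [sH iH] [sK iK]; split; first exact: zadd_zsub.
move=> o _ [x Hx [y Ky <-]]; exists (act o x); first exact: iH.
by exists (act o y); [apply: iK|rewrite opactD].
Qed.

Lemma finite_zadd H K : finite_set H -> finite_set K -> finite_set (zadd H K).
Proof. by move=> fH fK; apply: finite_image2. Qed.

Let fixed : set V := [set x | forall o, act o x = x].

Let fixed_zinv K : zsub K -> K `<=` fixed -> zinv K.
Proof. by move=> sK Kf; split=> // o x Kx; rewrite Kf. Qed.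

Let zsub_fixed : zsub fixed.
Proof.
by split=> [o|x y fx fy o]; rewrite ?opact0 // opactB fx fy.
Qed.

Lemma codcc_bigcap (N : set V) (G : set (V -> V)) : zsub N -> codcc N ->
    finite_set G ->
    (forall g, G g -> injective g /\ {morph g : x y / x - y}) ->
  let C := [set x | forall g, G g -> N (g x)] in zsub C /\ codcc C.
Proof.
move=> sN cN /finite_seqP[s ->]; elim: s => [|g s IHs] GP /=.
  split=> [|H sH dH]; first by split.
  by rewrite (_ : (fun n => _) = H) //; apply/funext => n; apply/seteqP; split=> x // [].
have [gI gB] := GP g (mem_head g s).
have [|sC cC] := IHs.
  by move=> g' sg'; apply: GP; rewrite /= inE sg' orbT.
set C := [set x | _] in sC cC; set C' := [set x | _].
have -> : C' = g @^-1` N `&` C.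
  apply/seteqP; split=> x.
    move=> h; split=> [|g' sg']; apply: h; first exact: mem_head.
    by rewrite inE sg' orbT.
  by move=> [Ng Cx] g'; rewrite inE => /orP[/eqP->|]; [|apply: Cx].
have sg : zsub (g @^-1` N).
  split=> [|x y Nx Ny]; last by rewrite /preimage /= gB; apply: zsubB.
  by rewrite /preimage /=; move: (gB 0 0); rewrite !subrr => ->; apply: zsub0.
by split; [apply: zsubI|apply: codccI => //; apply: codcc_preim].
Qed.

(* Let N be maximal with N ∩ fixed = 0. Its conjugates under the finitely many
   maps induced on U meet in an invariant subgroup without fixed points, hence
   trivially. *)
Lemma dcc_locally_finite U : zinv U ->
    (forall x, U x -> exists X, [/\ zinv X, finite_set X, X `<=` U & X x]) ->
  dcc (fun K => zsub K /\ K `<=` U).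
Proof.
move=> iU finU; have [G [fG GP Gact [g1 Gg1 g1U]]] := finite_action iU finU.
have sT : zsub [set: V] by [].
have [N mN] := exists_max_avoid fixed sT; have [sN _ NS _] := mN.
have cN : codcc N.
  apply: codcc_max_avoid mN => //.
  by apply: dcc_sub dcc_zinv => K [sK Kf]; apply: fixed_zinv.
have /=[sC cC] := codcc_bigcap sN cN fG GP.
set C := [set x | _] in sC cC.
have iUC : zinv (U `&` C).
  split; first by apply: zsubI => //; apply: zinv_zsub.
  move=> o x [Ux Cx]; split; first by case: iU => _; apply.
  by move=> g Gg; have [g' Gg' ->] := Gact o g Gg; last exact: Ux; apply: Cx.
(* The map [g1] is the identity on [U], which places the intersection of [U] and [C] inside [N]. *)
have UC0 : U `&` C `<=` [set 0].
  apply: contrapT => no; have [x [[Ux Cx] x0 xf]] := central_factor zinv0 iUC no.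
  apply: x0; apply: NS; first by rewrite -(g1U x Ux); apply: Cx.
  by move=> o; apply/eqP; rewrite -subr_eq0; apply/eqP/xf.
move=> H HP dH; have sH n := (HP n).1; apply: cC => //; exists 0%N => n _.
have e0 m : H m `&` C = [set 0].
  apply/seteqP; split=> [x [Hx Cx]|_ ->]; last by split; apply: zsub0.
  by apply: UC0; split=> //; have [_] := HP m; apply.
by rewrite !e0.
Qed.

Let locfin : set V := [set x | exists X, [/\ zinv X, finite_set X & X x]].

Let locfinP x : locfin x ->
  exists X, [/\ zinv X, finite_set X, X `<=` locfin & X x].
Proof. by move=> [X [iX fX Xx]]; exists X; split=> // y Xy; exists X. Qed.

Let zinv_locfin : zinv locfin.
Proof.
split; last by move=> o x [X [[sX iX] fX Xx]]; exists X; split=> //; apply: iX.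
split; first by exists [set 0]; split=> //; apply: zinv0.
move=> x y [X [iX fX Xx]] [Y [iY fY Yy]]; exists (zadd X Y); split.
- exact: zinv_zadd.
- exact: finite_zadd.
- apply: zsubB; [by apply: zadd_zsub; apply: zinv_zsub| |].
    by apply: zaddl => //; apply: zinv_zsub.
  by apply: zaddr => //; apply: zinv_zsub.
Qed.

Let finite_sub_locfin (D : set V) : finite_set D -> D `<=` locfin ->
  exists X, [/\ zinv X, finite_set X & D `<=` X].
Proof.
case/finite_seqP => s ->; elim: s => [|x s IHs] sU.
  by exists [set 0]; split=> //; apply: zinv0.
have [|X [iX fX sX]] := IHs.
  by move=> y ys; apply: sU; rewrite /= inE ys orbT.
have [|Y [iY fY Yx]] := sU x; first by rewrite /= mem_head.
exists (zadd X Y); split; [exact: zinv_zadd|exact: finite_zadd|].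
move=> y; rewrite /= inE => /orP[/eqP->|ys].
  by apply: zaddr => //; apply: zinv_zsub.
by apply: zaddl; [apply: zinv_zsub|apply: sX].
Qed.

(* If x is central modulo locfin and n x lies in a finite submodule Y, then the
   differences act o x - x lie in the preimage of Y under multiplication by n,
   which is finite. *)
Lemma dcc_operator_group : dcc (@zsub V).
Proof.
have [sU iU] := zinv_locfin.
have dU : dcc (fun K => zsub K /\ K `<=` locfin).
  exact: dcc_locally_finite zinv_locfin locfinP.
suff UT x : locfin x by apply: dcc_sub dU => K sK; split.
suff : [set: V] `<=` locfin by apply.
apply: contrapT => no.
have iT : zinv [set: V] by [].
have [y [_ nUy yU]] := central_factor zinv_locfin iT no.
clear x; apply: nUy; pose W : set V := [set z | forall o, locfin (act o z - z)].
have sW : zsub W.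
  split=> [o|z t Wz Wt o]; first by rewrite opact0 subrr; apply: zsub0.
  by rewrite opactB opprD addrACA -opprD; apply: zsubB.
have UW : locfin `<=` W by move=> z Uz o; apply: zsubB => //; apply: iU.
(* Every subgroup between [locfin] and [W] is invariant, so the chain condition on submodules makes
   [W] torsion modulo [locfin]. *)
have [|n n0 Uny] := dcc_torsion sW sU UW _ (yU : W y).
  apply: dcc_sub dcc_zinv => K [sK [UK KW]]; split=> // o z Kz.
  by rewrite -[act o z](subrK z); apply: zsubD => //; apply/UK/KW.
have [Y [iY fY Yny]] := Uny; have [sY actY] := iY.
pose D : set V := [set u | locfin u /\ Y (u *+ n)].
have sD : zsub D.
  split; first by split; rewrite ?mul0rn; apply: zsub0.
  by move=> z t [Uz Yz] [Ut Yt]; split; rewrite ?mulrnBl; apply: zsubB.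
have fD : finite_set D.
  apply: (finite_set_additive (@morphB_mulrn _ n) sD).
    apply: (@dcc_exponent_finite _ _ n) => //; last by move=> z [].
      split; first by split; [apply: zsub0|rewrite /= mul0rn].
      move=> z t [Dz z0] [Dt t0]; split; first exact: zsubB.
      by rewrite /= mulrnBl z0 t0 subrr.
    apply: dcc_sub dU => K [sK KD]; split=> //.
    by move=> z /KD[[]].
  by apply: sub_finite_set fY => _ [z [_ Yz] <-].
have [|X [iX fX DX]] := finite_sub_locfin fD; first by move=> z [].
have [sX actX] := iX.
have yX o : X (act o y - y).
  apply: DX; split; first exact: yU.
  by rewrite mulrnBl -opactMn; apply: zsubB => //; apply: actY.
have [m m0 ym0] : exists2 m, (0 < m)%N & y *+ m = 0.
  have [t t0 Ut] : exists2 t, (0 < t)%N & [set (0 : V)] (y *+ n *+ t).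
    apply: (@dcc_torsion _ locfin) => //; [exact: zinv_zsub zinv0| |].
      by move=> _ ->; apply: zsub0.
    by apply: dcc_sub dU => K [sK [_ KU]].
  by exists (n * t)%N; rewrite ?muln_gt0 ?n0 // mulrnA.
have fy := finite_zcyc m0 ym0.
(* All differences [act o y - y] lie in [X], so adding the finite cyclic group of [y] to [X]
   preserves invariance. *)
exists (zadd X (zcyc y)); split; last 2 first.
- exact: finite_zadd.
- by apply: zaddr => //; apply: zcyc_id.
have sXy : zsub (zadd X (zcyc y)) by apply: zadd_zsub => //; apply: zcyc_zsub.
split=> // o _ [z Xz [_ [k _ <-] <-]]; rewrite opactD; apply: zsubD => //.
  by apply: zaddl; [apply: zcyc_zsub|apply: actX].
have -> : act o (y *~ k) = act o y *~ k.
  case: k => k; first exact: opactMn.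
  by rewrite NegzE !mulrNz opactN -!pmulrn opactMn.
apply: zsubMz => //; rewrite -[act o y](subrK y).
by exists (act o y - y) => //; exists y => //; apply: zcyc_id.
Qed.

End OperatorGroups.

(** * Ideals as operator subgroups *)

Local Open Scope group_scope.
Local Open Scope brace_scope.

Ltac addb_simp := repeat progress
  rewrite ?oppbD ?oppbK -?addbA ?addKb ?addNKb ?addbN ?addNb ?addb0 ?add0b ?oppb0.

Section Operators.
Variable B : skewBraceType.
Implicit Types (a b c x y z : B) (H I J K X : set B).

Lemma addbIr a b c : b + a = c + a -> b = c.
Proof. by move=> e; rewrite -(addbK a b) e addbK. Qed.

Lemma subb_eq0 a b : a - b = 0 <-> a = b.
Proof. by split=> [e|->]; rewrite ?addbN // -(addbNK b a) e add0b. Qed.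

Lemma mulbN a b : a * - b = a - a * b + a.
Proof.
apply: (@addbI _ (a * b - a)); rewrite -mulbDr addbN mulg1.
by addb_simp.
Qed.

Variant op_kind := OpLambda | OpAdd | OpMul.

Definition act (o : op_kind * B) (x : B) : B :=
  match o.1 with
  | OpLambda => lambda o.2 x
  | OpAdd => - o.2 + (x + o.2)
  | OpMul => x ^ o.2
  end.

Definition asub H : Prop := is_subgroup (H : set (addg B)).

Lemma asubP H :
  asub H <-> [/\ H 0, forall x y, H x -> H y -> H (x + y) & forall x, H x -> H (- x)].
Proof. by []. Qed.

Lemma asub0 H : asub H -> H 0. Proof. by case. Qed.
Lemma asubD H x y : asub H -> H x -> H y -> H (x + y).
Proof. by case=> _ h _; apply: h. Qed.
Lemma asubN H x : asub H -> H x -> H (- x).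
Proof. by case=> _ _ h; apply: h. Qed.
Lemma asubB H x y : asub H -> H x -> H y -> H (x - y).
Proof. by move=> sH Hx Hy; apply: asubD => //; apply: asubN. Qed.
(** Closure under the multiplicative group comes from [x * y = x + lambda x y] and
    [x^-1 = - lambda x^-1 x]. *)
Lemma is_ideal_act I :
  is_ideal I <-> asub I /\ forall o x, I x -> I (act o x).
Proof.
split=> [[[sA sM] [_ nA] [_ nM] nl]|[sI iI]].
  split=> // -[[] a] x Ix; [exact: nl|exact: (nA x a)|exact: nM].
have il a x : I x -> I (lambda a x) by apply: (iI (OpLambda, a)).
have sM : is_subgroup I.
  split; first exact: asub0.
    by move=> x y Ix Iy; rewrite mulb_lambda; apply: asubD => //; apply: il.
  move=> x Ix; have -> : x^-1 = - lambda x^-1 x.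
    by rewrite /lambda mulVg addb0 oppbK.
  by apply: asubN => //; apply: il.
split=> //.
- by split=> // x a; apply: (iI (OpAdd, a)).
- by split=> // x a; apply: (iI (OpMul, a)).
Qed.

Lemma ideal_act (I : ideal B) o x : subbrace_set I x -> subbrace_set I (act o x).
Proof. by have /is_ideal_act[_] := idealP I; apply. Qed.

Lemma zeta_setE x : zeta_set x <-> forall o, act o x = x.
Proof.
split=> [zx [[] a]|fx b].
- exact: zeta_lambda.
- by have [_ _ e] := zx a; rewrite /act /= e addKb.
- by have [e _ _] := zx a; rewrite /act /= /conjg e mulKg.
have el := fx (OpLambda, b); have ea := fx (OpAdd, b); have em := fx (OpMul, b).
rewrite /act /= in el ea em.
have eD : x + b = b + x by rewrite -{2}ea addNKb.
have eM : x * b = b * x by rewrite -{2}em /conjg mulVKg.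
by split; rewrite // mulb_lambda el eD.
Qed.

Definition ideal_gen X : set B := smallest (@is_ideal B) X.

Lemma is_ideal_bigcap (F : set (set B)) :
  (forall I, F I -> is_ideal I) -> is_ideal (\bigcap_(I in F) I).
Proof.
move=> FI; have FP I : F I -> asub I /\ forall o x, I x -> I (act o x).
  by move=> /FI/is_ideal_act.
apply/is_ideal_act; split; last first.
  by move=> o x Fx I FI'; have [_ i] := FP I FI'; apply: i; apply: Fx.
apply/asubP; split=> [I|x y Fx Fy I|x Fx I] FI'; have [sI _] := FP I FI'.
- exact: asub0.
- by apply: asubD => //; [apply: Fx|apply: Fy].
- by apply: asubN => //; apply: Fx.
Qed.

Lemma ideal_gen_is_ideal X : is_ideal (ideal_gen X).
Proof. by apply: is_ideal_bigcap => I []. Qed.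

Lemma is_subbrace_gen X : is_subbrace (smallest (@is_subbrace B) X).
Proof.
split; split.
- by move=> S [[/asub0]].
- move=> x y Sx Sy S SX; have [[sS _] _] := SX.
  by apply: (asubD sS); [apply: Sx|apply: Sy].
- by move=> x Sx S SX; have [[sS _] _] := SX; apply: (asubN sS); apply: Sx.
- by move=> S [[/asub0]].
- move=> x y Sx Sy S SX; have [[_ [_ sS _]] _] := SX.
  by apply: sS; [apply: Sx|apply: Sy].
- by move=> x Sx S SX; have [[_ [_ _ sS]] _] := SX; apply: sS; apply: Sx.
Qed.

End Operators.

Lemma act_morph (B C : skewBraceType) (f : B -> C) k (a x : B) :
  is_brace_morphism f -> f (act (k, a) x) = act (k, f a) (f x).
Proof.
move=> fM; have [fD fMul] := fM; case: k.
- by rewrite /act /lambda /= fD fMul (morphN fM).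
- by rewrite /act /= !fD (morphN fM).
- by rewrite /act /conjg /= !fMul (morphV fM).
Qed.

Section Quotients.
Variable B : skewBraceType.
Implicit Types (I : ideal B) (x y : B).

Lemma proj_eq0 (I : ideal B) x : proj I x = 0 :> quotient I <-> subbrace_set I x.
Proof.
have -> : (0 : quotient I) = proj I 0 by [].
rewrite eq_proj eq_coset addb0; split=> [/(subN (S := I))|/subN//].
  by rewrite oppbK.
Qed.

Lemma eq_projN (I : ideal B) x y :
  proj I x = proj I y :> quotient I <-> subbrace_set I (x - y).
Proof.
have [pD _] := proj_morph I.
rewrite -proj_eq0 pD (morphN (proj_morph I)).
exact: iff_sym (@subb_eq0 (quotient I) _ _).
Qed.

Lemma zeta_aboveE (I : ideal B) x :
  subbrace_set (zeta_above I) x <-> forall o, subbrace_set I (act o x - x).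
Proof.
have pM := proj_morph I; rewrite [subbrace_set _ _]/(zeta_set (proj I x)).
split=> [/zeta_setE fx [k a]|fx].
  by apply/eq_projN; rewrite (act_morph k a x pM); apply: (fx (k, proj I a)).
apply/zeta_setE => -[k q]; have [a ->] := proj_surj q.
by have /eq_projN := fx (k, a); rewrite (act_morph k a x pM).
Qed.

End Quotients.

(** Every nonzero ideal of a quotient contains a nonzero central element; this is what the later
    parts take from local multipermutationality. *)
Definition has_central_factors (B : skewBraceType) : Prop :=
  forall K L : ideal B, ~ L `<=` K ->
    exists x, [/\ subbrace_set L x, ~ subbrace_set K x &
      forall o, subbrace_set K (act o x - x)].

Section TwoSided.
Variable B : skewBraceType.
Hypothesis hts : two_sided B.
Implicit Types (a b c x y z : B) (H I J K X : set B).

Lemma mulDb a b c : (b + c) * a = b * a - a + c * a.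
Proof. exact: hts. Qed.

Lemma mulNb a b : - b * a = a - b * a + a.
Proof.
apply: (@addbI _ (b * a - a)); rewrite -mulDb addbN mul1g.
by addb_simp.
Qed.

Lemma conjD a b c : (b + c) ^ a = b ^ a + c ^ a.
Proof.
rewrite /conjg [(b + c) * a]mulDb !mulbDr mulbN mulVg.
by addb_simp.
Qed.

Lemma actD o x y : act o (x + y) = act o x + act o y.
Proof.
case: o => -[] a; rewrite /act /=; [exact: lambdaD| |exact: conjD].
by addb_simp.
Qed.

Lemma act0 o : act o (0 : B) = 0.
Proof. by apply: (@addbI _ (act o 0)); rewrite -actD !addb0. Qed.

Lemma actN o x : act o (- x) = - act o x.
Proof. by apply: (@addbI _ (act o x)); rewrite -actD !addbN act0. Qed.

Lemma conj_lambda a b x : lambda b x ^ a = lambda (b ^ a) (x ^ a).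
Proof.
rewrite /lambda conjD -conjMg; congr (_ + _).
exact: (actN (OpMul, a)).
Qed.

Lemma two_sided_sub (S : subbrace B) : two_sided (subbrace_brace S).
Proof. by move=> a b c; apply: incl_inj; apply: hts. Qed.

Lemma two_sided_quotient (I : ideal B) : two_sided (quotient I).
Proof.
have [pD pM] := proj_morph I; have pN := morphN (proj_morph I).
move=> p q r; have [a ->] := proj_surj p; have [b ->] := proj_surj q.
by have [c ->] := proj_surj r; rewrite -!(pD, pM, pN) hts.
Qed.

End TwoSided.

(** * Nilpotency of two-sided multipermutational braces *)

(** The usual third operation [- a + a b - b] of brace theory; [star a] is the map
    [lambda a - 1]. *)
Definition star (B : skewBraceType) (a b : B) : B := lambda a b - b.

Section SocleAction.
Variable B : skewBraceType.
Hypothesis hts : two_sided B.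
Implicit Types (a b x : B).

Lemma star_Soc a x : Soc_set x -> Soc_set (star a x).
Proof. by move=> Sx; apply: (subD (S := Soc B)); [apply: Soc_lambda|apply: (subN (S := Soc B))]. Qed.

Lemma Soc_central x b : Soc_set x -> x + b = b + x.
Proof. by case/Soc_setP. Qed.

(** Two-sidedness expands [(a + b) * x]; the summand [star a x] lies in the socle, so it is
    additively central and moves past [b]. *)
Lemma star_addl a b x : Soc_set x -> star (a + b) x = star a x + star b x.
Proof.
move=> Sx; have Sa := star_Soc a Sx.
rewrite [in LHS]/star /lambda (mulDb hts) !mulb_lambda -[LHS]addbA.
have -> : a + lambda a x - x + (b + lambda b x) - x = a + b + (star a x + star b x).
  have := Soc_central b Sa; rewrite /star; move: (lambda a x) (lambda b x) => p q e.
  by rewrite -(addbA a p) -(addbA a) (addbA (p - x)) e -!addbA.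
exact: addKb.
Qed.

(** Compute [star (a * b) x] twice: from [a * b = a + (star a b + b)] by additivity, and from
    [lambda (a * b)] as a composite; then cancel. *)
Lemma star_star a b x : Soc_set x -> star (star a b) x = star a (star b x).
Proof.
move=> Sx; have Sb := star_Soc b Sx; have Sab := star_Soc a Sb.
have : star (a * b) x = star a x + (star (star a b) x + star b x).
  have -> : a * b = a + (star a b + b) by rewrite /star addbNK mulb_lambda.
  by rewrite !star_addl.
have -> : star (a * b) x = star a x + (star a (star b x) + star b x).
  have e1 : lambda b x = star b x + x by rewrite /star addbNK.
  have e2 : lambda a (star b x) = star a (star b x) + star b x.
    by rewrite {2}/star addbNK.
  rewrite {1}/star lambdaM e1 lambdaD e2 -addbA.
  exact: esym (Soc_central _ (star_Soc a Sx)).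
by move/addbI/addbIr.
Qed.

End SocleAction.

Section Multipermutational.
Variable B : skewBraceType.
Hypothesis hts : two_sided B.
Implicit Types (I J K : ideal B) (a b x : B).

Lemma sub_zeta_above I : I `<=` zeta_above I.
Proof.
by move=> x Ix; apply/zeta_aboveE => o; apply: subD; [apply: ideal_act|apply: subN].
Qed.

Lemma proj_star I a b : proj I (star a b) = star (proj I a) (proj I b) :> quotient I.
Proof.
have pM := proj_morph I; have [pD _] := pM.
by rewrite /star pD (morphN pM) (act_morph OpLambda a b pM).
Qed.

Lemma star_Soc_above I a b : subbrace_set (Soc_above I) a -> subbrace_set I (star a b).
Proof.
move=> /Soc_setP[fa _]; apply/proj_eq0.
by rewrite proj_star /star fa addbN.
Qed.

(** On the socle modulo [I], additive conjugation is trivial and conjugation by [b] is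
    [lambda b^-1], so only the maps [lambda b] remain to be tested. *)
Lemma zeta_above_Soc I K x : I `<=` K -> subbrace_set (Soc_above I) x ->
  (forall b, subbrace_set K (star b x)) -> subbrace_set (zeta_above K) x.
Proof.
move=> IK Sx Kx; apply/zeta_aboveE => -[[] b]; first exact: Kx.
  apply: IK; apply/eq_projN; rewrite (act_morph OpAdd b x (proj_morph I)).
  by rewrite /act /= (Soc_central _ Sx) addKb.
have e : subbrace_set I (x ^ b - lambda b^-1 x).
  apply/eq_projN; rewrite (act_morph OpMul b x (proj_morph I)).
  rewrite (act_morph OpLambda b^-1 x (proj_morph I)) /act /= (conj_Soc _ Sx).
  by rewrite (morphV (proj_morph I)).
have := subD (IK _ e) (Kx b^-1).
by rewrite /star addbA addbNK.
Qed.

(* With I = Soc_j, the sets of all x in Soc_(j+1) annihilated modulo I by Soc_i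
   decrease to the elements central modulo I, and star b moves each of them
   into the next one because Soc_i+1 * B lies in Soc_i. *)
Lemma multipermutational_nilpotent K : finite_multipermutational_level B ->
  exists m, forall x, subbrace_set (iter m (@zeta_above B) K) x.
Proof.
case=> n en; suff /(_ n)[m sub] : forall j, exists m, Soc_series B j `<=` iter m (@zeta_above B) K.
  by exists m => x; apply: sub; rewrite en.
elim=> [|j [m IH]]; first by exists 0%N => _ ->; apply: sub0.
set I := Soc_series B j in IH.
(* [k] is the distance from [i] to the length [n] of the socle series. At [i = 0] the condition on
   [x] is void, which covers all of [Soc_above I]. *)
suff main k i : (k + i = n)%N -> forall x, subbrace_set (Soc_above I) x ->
    (forall a, subbrace_set (Soc_series B i) a -> subbrace_set I (star a x)) ->
    subbrace_set (iter (k + m).+1 (@zeta_above B) K) x.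
  exists (n + m).+1 => x Sx; apply: (main n 0%N) => //; first exact: addn0.
  by move=> _ ->; rewrite /star lambda1 addbN; apply: sub0.
have Imk q : I `<=` iter (q + m) (@zeta_above B) K.
  elim: q => [//|q IHq]; apply: subset_trans IHq _; rewrite addSn.
  exact: sub_zeta_above.
elim: k i => [|k IHk] i ein x Sx Ix.
  apply: (zeta_above_Soc (Imk 0%N) Sx) => b; apply: IH; apply: Ix.
  by rewrite -[i]add0n ein en.
apply: (zeta_above_Soc (Imk k.+1) Sx) => b; apply: (IHk i.+1).
- by rewrite addnS.
- by apply: subD; [apply: ideal_lambda|apply: subN].
move=> a Sa; apply/proj_eq0; rewrite 2!proj_star -star_star //.
  by rewrite -2!proj_star; apply/proj_eq0; apply: Ix; apply: star_Soc_above.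
exact: two_sided_quotient.
Qed.

(** Descent along the iterated centres above [K], which exhaust [B]: if [x] is central modulo one of
    them, the hypothesis puts [x] into it. *)
Lemma multipermutational_engel K x : finite_multipermutational_level B ->
    (forall J, K `<=` J -> (forall o, subbrace_set J (act o x - x)) ->
      subbrace_set J x) ->
  subbrace_set K x.
Proof.
move=> /(multipermutational_nilpotent K)[m Em] HJ.
move: (Em x); elim: m {Em} => [//|m IHm] /zeta_aboveE Ex; apply: IHm; apply: HJ => //.
elim: (m) => [//|q IHq]; apply: subset_trans IHq _; exact: sub_zeta_above.
Qed.

End Multipermutational.

(** * Central chief factors *)

Lemma dcc_is_ideal (B : skewBraceType) : i_artinian B -> dcc (@is_ideal B).
Proof. by move=> hia H HP dH; apply: (hia (fun n => ideal_of_set (HP n))). Qed.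

Section CentralFactors.
Variable B : skewBraceType.
Hypothesis hts : two_sided B.
Implicit Types (x y z : B) (X : set B).

(** Deriving [x] from [y] takes finitely many operators and intermediate values. [X] collects them,
    so a subbrace containing [X] can repeat the derivation; the elements with such an [X] form an
    ideal. *)
Lemma ideal_gen_local y x : ideal_gen [set y] x ->
  exists X, [/\ finite_set X, X x & forall (S : subbrace B), X `<=` S ->
    forall (J : ideal (subbrace_brace S)),
      (forall y' : subbrace_brace S, incl y' = y -> subbrace_set J y') ->
      forall x' : subbrace_brace S, incl x' = x -> subbrace_set J x'].
Proof.
move: x; apply: smallest_sub; last first.
  by move=> _ ->; exists [set y]; split=> // S yS J Jy x'; apply: Jy.
have lift (S : subbrace B) z : subbrace_set S z -> {z' : subbrace_brace S | incl z' = z}.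
  by move=> Sz; exists (exist _ z Sz).
apply/is_ideal_act; split; first apply/asubP; first split.
- exists [set 0]; split=> // S _ J _ x' ex; have -> : x' = 0 by apply: incl_inj.
  exact: (sub0 J).
- move=> z1 z2 [X1 [f1 Xz1 J1]] [X2 [f2 Xz2 J2]].
  exists (X1 `|` X2 `|` [set z1 + z2]); split; last 1 first.
  + move=> S XS J Jy x' ex.
    have XS1 : X1 `<=` S by move=> t Xt; apply: XS; left; left.
    have XS2 : X2 `<=` S by move=> t Xt; apply: XS; left; right.
    have [z1' e1] := lift S z1 (XS1 _ Xz1); have [z2' e2] := lift S z2 (XS2 _ Xz2).
    have -> : x' = z1' + z2' by apply: incl_inj; rewrite ex -e1 -e2.
    by apply: subD; [apply: J1 e1|apply: J2 e2].
  + by rewrite !finite_setU; split=> //; split.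
  + by right.
- move=> z [X [fX Xz JX]]; exists (X `|` [set - z]); split; last 1 first.
  + move=> S XS J Jy x' ex.
    have XS' : X `<=` S by move=> t Xt; apply: XS; left.
    have [z' e] := lift S z (XS' _ Xz).
    have -> : x' = - z' by apply: incl_inj; rewrite ex -e.
    by apply: subN; apply: JX e.
  + by rewrite finite_setU.
  + by right.
move=> [k a] z [X [fX Xz JX]]; exists (X `|` [set a; act (k, a) z]); split.
+ by rewrite finite_setU; split=> //; apply: finite_set2.
+ by right; right.
move=> S XS J Jy x' ex.
have XS' : X `<=` S by move=> t Xt; apply: XS; left.
have Sa : subbrace_set S a by apply: XS; right; left.
have [z' e] := lift S z (XS' _ Xz); have [a' ea] := lift S a Sa.
have -> : x' = act (k, a') z'.
  by apply: incl_inj; rewrite ex -e -ea (act_morph k a' z' (incl_morph S)).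
by apply: ideal_act; apply: JX e.
Qed.

Hypothesis hlm : locally_multipermutational B.
Hypothesis hia : i_artinian B.

(* Take M minimal among the ideals inside L but not inside K. If x in M \ K is
   not central modulo K, some y = act o x - x generates M and hence x; this
   already holds in a finitely generated subbrace, which is nilpotent. *)
Lemma exists_central_factor : has_central_factors B.
Proof.
move=> K L nLK.
have [||M [[iM [ML nMK]] minM]] :=
  @dcc_minimal _ (fun I => is_ideal I /\ I `<=` L /\ ~ I `<=` K) L.
- by apply: dcc_sub (dcc_is_ideal hia) => I [].
- by split; [exact: idealP|split].
have [x [Mx nKx]] : exists x, M x /\ ~ subbrace_set K x.
  apply: contrapT => no; apply: nMK => x Mx; apply: contrapT => nKx.
  by apply: no; exists x.
exists x; split=> //; first exact: ML.
move=> [k b]; apply: contrapT => nKy; set y := act (k, b) x - x in nKy.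
have [sM aM] := (is_ideal_act M).1 iM.
have My : M y by apply: asubB => //; apply: aM.
have genM : ideal_gen [set y] `<=` M by apply: smallest_sub => // _ ->.
have eM : ideal_gen [set y] = M.
  apply: minM => //; split; first exact: ideal_gen_is_ideal.
  split; first exact: subset_trans ML.
  by move=> sub; apply: nKy; apply: sub; apply: sub_gen_smallest.
have [X [fX Xx JX]] : exists X, [/\ finite_set X, X x & forall (S : subbrace B),
    X `<=` S -> forall (J : ideal (subbrace_brace S)),
      (forall y' : subbrace_brace S, incl y' = y -> subbrace_set J y') ->
      forall x' : subbrace_brace S, incl x' = x -> subbrace_set J x'].
  by apply: ideal_gen_local; rewrite eM.
(* [b] is adjoined so that [y] is obtained from [x] inside [S]. *)
pose S := Subbrace (is_subbrace_gen (X `|` [set b])).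
have XS : X `|` [set b] `<=` S by apply: sub_gen_smallest.
have XS' : X `<=` S by move=> t Xt; apply: XS; left.
pose x' : subbrace_brace S := exist _ x (XS' _ Xx).
have [b' eb] : exists b' : subbrace_brace S, incl b' = b.
  by exists (exist _ b (XS b (or_intror erefl))).
apply: nKx; rewrite -[x]/(incl x').
apply: (@multipermutational_engel _ (two_sided_sub hts (S := S))
  (preim_ideal (incl_morph S) K)).
  apply: hlm; exists (X `|` [set b]); split=> //.
  by rewrite finite_setU.
move=> J KJ Jx; apply: (JX S XS' J) => // y' ey.
have -> : y' = act (k, b') x' - x'; last exact: Jx.
by apply: incl_inj; rewrite ey /y -eb -(act_morph k b' x' (incl_morph S)).
Qed.

End CentralFactors.

(** * Hypercentrality *)

Lemma cantor_injective (T : Type) (f : set T -> T) : ~ injective f.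
Proof.
move=> fI; pose D := [set t | exists2 A, f A = t & ~ A t].
have nD : ~ D (f D) by move=> DD; have [A /fI -> nA] := DD; exact: nA.
by apply: (nD); exists D.
Qed.

Section WellOrder.
Variables (W : Type) (R : rel W).
Hypothesis woR : well_order R.
Implicit Types u v w : W.

Lemma well_order_total u v : [\/ strictly_below R u v, u = v | strictly_below R v u].
Proof.
have [|z [[/asboolP zuv zmin] _]] := woR (A := [pred w | `[< w = u \/ w = v >]]).
  by exists u; apply/asboolP; left.
have Rzu : R z u by apply: zmin; apply/asboolP; left.
have Rzv : R z v by apply: zmin; apply/asboolP; right.
have [->|neq] := pselect (u = v); first exact: Or32.
have {zmin} [ez|ez] := zuv; rewrite ez in Rzu Rzv.
  by apply: Or31.
by apply: Or33; split=> // /esym.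
Qed.

(** Minima of nonempty sets are unique, and here [u] and [v] are both minima of their pair. *)
Lemma well_order_antisym u v : R u v -> R v u -> u = v.
Proof.
move=> Ruv Rvu.
have Rrefl w : R w w.
  have [|z [[/asboolP -> zmin] _]] := woR (A := [pred t | `[< t = w >]]).
    by exists w; apply/asboolP.
  by apply: zmin; apply/asboolP.
have [|z [_ uniq_z]] := woR (A := [pred w | `[< w = u \/ w = v >]]).
  by exists u; apply/asboolP; left.
rewrite -(uniq_z u); last first.
  split; first by apply/asboolP; left.
  by move=> w /asboolP[->|->].
apply: uniq_z; split; first by apply/asboolP; right.
by move=> w /asboolP[->|->].
Qed.

Lemma well_order_wf : well_founded (strictly_below R).
Proof.
move=> w0; apply: contrapT => nw0.
have [|z [[/asboolP zA zmin] _]] :=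
  woR (A := [pred w | `[< ~ Acc (strictly_below R) w >]]).
  by exists w0; apply/asboolP.
apply: zA; constructor => v [Rvz nvz]; apply: contrapT => nv; apply: nvz.
by apply: well_order_antisym => //; apply: zmin; apply/asboolP.
Qed.

End WellOrder.

Section CentralSeries.
Variable B : skewBraceType.
Hypothesis central_factor : has_central_factors B.
Variables (W : Type) (R : rel W).
Hypothesis woR : well_order R.

(** One formula for all indices: the generated ideal is zero, the next centre or the union,
    according to the kind of [w]. *)
Let step w (Z : forall v, strictly_below R v w -> ideal B) : ideal B :=
  ideal_of_set (ideal_gen_is_ideal
    [set x | exists v (h : strictly_below R v w), subbrace_set (zeta_above (Z v h)) x]).

Let Z : W -> ideal B := Fix (well_order_wf woR) (fun _ => ideal B) step.

Let ZE w : Z w = ideal_gen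
  [set x | exists2 v, strictly_below R v w & subbrace_set (zeta_above (Z v)) x] :> set B.
Proof.
rewrite {1}/Z Fix_eq /=; last first.
  move=> v f g fg; congr step.
  by apply: functional_extensionality_dep => u; apply: functional_extensionality_dep.
congr ideal_gen; apply/seteqP.
by split=> x; [case=> v [h Zx]; exists v|case=> v h Zx; exists v, h].
Qed.

Let zeta_above_sub v w : strictly_below R v w -> zeta_above (Z v) `<=` Z w.
Proof. by move=> h x Zx; rewrite ZE; apply: sub_gen_smallest; exists v. Qed.

Let Z_mono v w : strictly_below R v w -> Z v `<=` Z w.
Proof. by move=> h; apply: subset_trans (zeta_above_sub h); apply: sub_zeta_above. Qed.

Let Z_central_series : is_central_series R Z.
Proof.
move=> w; split.
- move=> zw; rewrite ZE; apply/seteqP; split; last first.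
    by move=> _ ->; apply: asub0; exact: ((is_ideal_act _).1 (ideal_gen_is_ideal _)).1.
  apply: smallest_sub; first exact: zero_is_ideal.
  by move=> x [v h _]; case: (zw v).
- move=> v [vw nb]; apply/seteqP; split; last exact: zeta_above_sub.
  rewrite ZE; apply: smallest_sub; first exact: idealP.
  move=> x [u uw Zx]; have [uv|euv|vu] := well_order_total woR u v.
  + by apply: sub_zeta_above; apply: zeta_above_sub Zx.
  + by rewrite -euv.
  + by case: (nb u).
move=> [nz ns]; apply/seteqP; split; last first.
  by move=> x [v /= vw Zx]; apply: Z_mono Zx.
have [u0 u0w] : exists u, strictly_below R u w.
  by apply: contrapT => no; apply: nz => u uw; apply: no; exists u.
rewrite ZE; apply: smallest_sub; last first.
  move=> x [v vw Zx]; have [u [vu uw]] : exists u, strictly_below R v u /\ strictly_below R u w.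
    apply: contrapT => no; apply: (ns v); split=> // u [vu uw].
    by apply: no; exists u.
  by exists u => //; apply: zeta_above_sub Zx.
apply/is_ideal_act; split; first apply/asubP; first split.
- by exists u0 => //; apply: sub0.
- move=> x y [u /= uw Zx] [v /= vw Zy]; have [uv|euv|vu] := well_order_total woR u v.
  + by exists v => //; apply: subD => //; apply: Z_mono Zx.
  + by exists v => //; apply: subD => //; rewrite -euv.
  + by exists u => //; apply: subD => //; apply: Z_mono Zy.
- by move=> x [u uw Zx]; exists u => //; apply: subN.
- by move=> o x [u uw Zx]; exists u => //; apply: ideal_act.
Qed.

(** If the series never reached [B], central factors would make it strictly increasing, hence
    injective in its index. *)
Lemma hypercentral_large : (forall f : W -> set B, ~ injective f) -> hypercentral B.
Proof.
move=> noinj; exists W, R, Z; split=> //; apply: contrapT => no.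
apply: (noinj (fun w => Z w)).
have strict v w : strictly_below R v w -> Z v <> Z w :> set B.
  move=> vw e; apply: no; exists v; apply/seteqP; split=> // y _.
  apply: contrapT => nZy.
  have isT : is_ideal [set: B] by apply/is_ideal_act.
  have [|x [_ nZx Zx]] := central_factor (K := Z v) (L := ideal_of_set isT).
    by move=> sub; apply: nZy; apply: sub.
  by apply: nZx; rewrite e; apply: (zeta_above_sub vw); apply/zeta_aboveE.
by move=> v w e; case: (well_order_total woR v w) => // /strict; rewrite e.
Qed.

End CentralSeries.

(** By Cantor, [set (set B)] is too large to index pairwise distinct subsets of [B]. *)
Lemma central_factor_hypercentral (B : skewBraceType) :
  has_central_factors B -> hypercentral B.
Proof.
move=> cf; have [R woR] := well_ordering_principle (set (set B)).
by apply: (hypercentral_large cf woR) => f; apply: cantor_injective.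
Qed.

(** * Centralisers and solubility *)

Definition commuting (B : skewBraceType) (b x : B) : Prop :=
  [/\ b * x = b + x, x * b = b + x & x + b = b + x].

Definition Cent (B : skewBraceType) (X : set B) : set B :=
  [set b | forall x, X x -> commuting b x].

Section Centralisers.
Variable B : skewBraceType.
Hypothesis hts : two_sided B.
Implicit Types (a b c d u v x y z : B).

Lemma commuting_sym b x : commuting b x -> commuting x b.
Proof. by case=> e1 e2 e3; split; rewrite ?e1 ?e2 e3. Qed.

Lemma commuting_act b x : commuting b x <-> forall k, act (k, b) x = x.
Proof.
split=> [[e1 e2 e3]|fx].
  case; rewrite /act /=; first by rewrite /lambda e1 addKb.
    by rewrite e3 addKb.
  by rewrite /conjg e2 -e1 mulKg.
have el := fx OpLambda; have ea := fx OpAdd; have em := fx OpMul.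
rewrite /act /= in el ea em; have e1 : b * x = b + x by rewrite mulb_lambda el.
split=> //; first by rewrite -e1 -{2}em /conjg mulVKg.
by rewrite -{2}ea addNKb.
Qed.

Variable X : ideal B.

Lemma addb_conj_fixed c x u : subbrace_set X u ->
  (forall y, subbrace_set X y -> y + c = c + y) -> x - u + c + u = x + c.
Proof. by move=> Xu cX; rewrite -addbA -cX // addbA addbNK. Qed.

(** [X] is stable under the operators, so [b] also commutes with elements such as [lambda a x] and
    [x ^ a]; the distributive laws on both sides reduce the claim to these. *)
Lemma Cent_is_ideal : is_ideal (Cent X).
Proof.
have XP k a x : subbrace_set X x -> subbrace_set X (act (k, a) x) by apply: ideal_act.
apply/is_ideal_act; split; first apply/asubP; first split.
- by move=> x _; split; rewrite ?mul1g ?mulg1 ?addb0 ?add0b.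
- move=> b c Cb Cc x Xx; have [b1 b2 b3] := Cb x Xx; have [c1 c2 c3] := Cc x Xx.
  split; [rewrite (mulDb hts) b1 c1|rewrite mulbDr b2 c2|].
  + by rewrite addbK addbA.
  + by rewrite addbK addbA.
  + by rewrite addbA b3 -addbA c3 addbA.
- move=> b Cb x Xx; have [b1 b2 b3] := Cb x Xx.
  split; [rewrite (mulNb hts) b1|rewrite mulbN b2|].
  + by rewrite oppbD addbA addbN add0b.
  + by rewrite oppbD addbA addbN add0b.
  + by apply: (@addbI _ b); rewrite addNKb addbA -b3 addbK.
move=> [k a] b Cb x Xx.
have [c1 c2 c3] : [/\ act (k, a) b * x = x + act (k, a) b,
  x * act (k, a) b = x + act (k, a) b & x + act (k, a) b = act (k, a) b + x]; last first.
  by split; rewrite -?c3.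
have bX y : subbrace_set X y -> y + b = b + y by move=> Xy; have [] := Cb y Xy.
pose u := lambda a x; have Xu : subbrace_set X u by apply: (XP OpLambda).
have eu : a * x = a + u by rewrite mulb_lambda.
pose v := x ^ a; have Xv : subbrace_set X v by apply: (XP OpMul).
have ev : x * a = a * v by rewrite /v /conjg mulVKg.
have [bx1 bx2 bx3] := Cb x Xx; have [bv1 bv2 bv3] := Cb v Xv.
case: k; rewrite /act /=.
- have cX y : subbrace_set X y -> y + lambda a b = lambda a b + y.
    move=> Xy; rewrite -[y](lambdaK a) -!lambdaD bX //; exact: (XP OpLambda).
  split; last exact: cX.
  + rewrite [in LHS]/lambda (mulDb hts) (mulNb hts) -mulgA bx1 mulbDr eu.
    rewrite -[RHS](addb_conj_fixed x Xu cX) /lambda.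
    by addb_simp.
  + rewrite [in LHS]/lambda mulbDr mulbN mulgA ev -[a * v * b]mulgA bv2 -bv3 mulbDr /lambda.
    by addb_simp.
- pose c := - a + (b + a).
  have cX y : subbrace_set X y -> y + c = c + y.
    move=> Xy; have Xy' : subbrace_set X (a + (y - a)).
      by have := XP OpAdd (- a) y Xy; rewrite /act /= oppbK.
    apply: (@addbI _ a); transitivity (a + (y - a) + b + a).
      by rewrite /c; addb_simp.
    by rewrite (bX _ Xy') /c; addb_simp.
  pose w := lambda a v; have Xw : subbrace_set X w by apply: (XP OpLambda).
  have ew : x * a = a + w by rewrite ev mulb_lambda.
  split; last exact: cX.
  + rewrite (mulDb hts) (mulNb hts) (mulDb hts) bx1 eu.
    rewrite -[RHS](addb_conj_fixed x Xu cX) /c.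
    by addb_simp.
  + rewrite mulbDr mulbN mulbDr bx2 ew.
    rewrite -[RHS](addb_conj_fixed x Xw cX) /c.
    by addb_simp.
- pose y := x ^ a^-1; have Xy : subbrace_set X y by apply: (XP OpMul).
  have -> : x = y ^ a by rewrite /y conjgKV.
  have [y1 y2 y3] := Cb y Xy.
  by split; rewrite -?conjMg -?(conjD hts) ?y1 ?y2 ?y3.
Qed.

Definition cent_ideal : ideal B := ideal_of_set Cent_is_ideal.

(** [B] modulo [Cent X] is faithfully represented by its operators on [X]. The map [lambda u]
    carries [u^-1 * v] to [- u + v], so both lie in an ideal together. *)
Lemma Cent_subP u v : Cent X (- u + v) <->
  forall k x, subbrace_set X x -> act (k, u) x = act (k, v) x.
Proof.
have XP k a x : subbrace_set X x -> subbrace_set X (act (k, a) x) by apply: ideal_act.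
pose e := - u + v; pose d := u^-1 * v.
have ed : lambda u d = e by rewrite /lambda /d mulVKg.
have ed' : d = lambda u^-1 e by rewrite -ed lambdaVK.
split=> [Ce|same].
  have Cd : Cent X d by rewrite ed'; apply: (@ideal_lambda _ cent_ideal).
  move=> k x Xx; case: k.
  - have -> : v = u * d by rewrite /d mulVKg.
    rewrite /act /= lambdaM; congr lambda.
    by have /commuting_act/(_ OpLambda) := Cd x Xx.
  - have -> : v = u + e by rewrite /e addNKb.
    have Xi := XP OpAdd u x Xx; have /commuting_act/(_ OpAdd) := Ce _ Xi.
    by rewrite /act /= => {1}<-; addb_simp.
  - have -> : v = u * d by rewrite /d mulVKg.
    rewrite /act /= conjgM.
    by have /commuting_act/(_ OpMul) := Cd _ (XP OpMul u x Xx).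
rewrite -/e -ed; apply: (@ideal_lambda _ cent_ideal) => x Xx.
have ie y : subbrace_set X y -> - e + (y + e) = y.
  move=> Xy; have := same OpAdd _ (XP OpAdd (- u) y Xy).
  rewrite /act /= oppbK => ey; rewrite /e.
  have {2}-> : y = - u + (u + (y - u) + u) by addb_simp.
  by rewrite ey; addb_simp.
apply/commuting_act; case; rewrite /act /=.
- have := same OpLambda x Xx; rewrite /act /= => e'.
  by rewrite /d lambdaM -e' lambdaVK.
- rewrite ed' -[x in LHS](lambdaVK u) -lambdaN -!lambdaD ie ?lambdaVK //.
  exact: (XP OpLambda).
- rewrite /d conjgM; have := same OpMul _ (XP OpMul u^-1 x Xx).
  by rewrite /act /= => <-; rewrite conjgKV.
Qed.

End Centralisers.

(** They all vanish exactly when the two operations agree and commute on [K]; the ideal they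
    generate is the derived ideal. *)
Definition defects (B : skewBraceType) (K : set B) : set B :=
  [set d | exists a b, [/\ K a, K b &
    d = - (a + b) + a * b \/ d = - (a + b) + (b + a)]].

Definition derived (B : skewBraceType) (K : set B) : ideal B :=
  ideal_of_set (ideal_gen_is_ideal (defects K)).

Section Derived.
Variable B : skewBraceType.
Hypothesis hts : two_sided B.
Implicit Types (a b k x y : B) (K L : ideal B).

Lemma defects_sub K : defects K `<=` derived K.
Proof. exact: sub_gen_smallest. Qed.

Lemma derived_sub K : derived K `<=` K.
Proof.
apply: smallest_sub; first exact: idealP.
move=> _ [a [b [Ka Kb [->|->]]]]; apply: subD;
  by [apply: subN; apply: subD|apply: subM|apply: subD].
Qed.

(** Equal defects against [L] mean equal operators on [L]. For conjugation, apply [lambda u], which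
    turns [x ^ u] into [- u + x * u]. *)
Lemma Cent_sub_defects L u v :
    (forall x, subbrace_set L x -> exists s t r,
      [/\ u * x = u + x + s, x * u = u + x + t & x + u = u + x + r] /\
      [/\ v * x = v + x + s, x * v = v + x + t & x + v = v + x + r]) ->
  Cent L (- u + v).
Proof.
move=> uvL; apply/(Cent_subP hts) => k x Lx.
have lE y : subbrace_set L y -> lambda u y = lambda v y.
  move=> /uvL[s [t [r [[e1 _ _] [e1' _ _]]]]].
  by rewrite /lambda e1 e1' -!addbA !addKb.
have [s [t [r [[_ e2 e3] [_ e2' e3']]]]] := uvL x Lx.
case: k; rewrite /act /=; [exact: lE| |].
  by rewrite e3 e3' -!addbA !addKb.
have : lambda u (x ^ u) = lambda u (x ^ v).
  rewrite [RHS]lE; last exact: (@ideal_conj _ L).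
  by rewrite /lambda /conjg !mulVKg e2 e2' -!addbA !addKb.
by move/(congr1 (lambda u^-1)); rewrite !lambdaVK.
Qed.

(** [k] vanishes modulo [I] and [x] is central modulo [J], so the three terms agree with [k + x]
    modulo either ideal. *)
Lemma defect_mem (I J : ideal B) k x : subbrace_set I k ->
    subbrace_set (zeta_above J) x ->
  exists f l g, [/\ subbrace_set I f /\ subbrace_set J f,
    subbrace_set I l /\ subbrace_set J l, subbrace_set I g /\ subbrace_set J g &
    [/\ k * x = k + x + f, x * k = k + x + l & x + k = k + x + g]].
Proof.
move=> Ik Jx.
have [pD pM] := proj_morph I; have [qD qM] := proj_morph J.
have pN := morphN (proj_morph I); have qN := morphN (proj_morph J).
have pk : proj I k = 0 by apply/proj_eq0.
have [z1 z2 z3] := Jx (proj J k); rewrite -!(qD, qM) in z1 z2 z3.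
exists (- (k + x) + k * x), (- (k + x) + x * k), (- (k + x) + (x + k)).
have Jd y : proj J y = proj J (k + x) -> subbrace_set J (- (k + x) + y).
  by move=> e; apply/eq_coset/eq_proj.
have Id y : proj I y = proj I (k + x) -> subbrace_set I (- (k + x) + y).
  by move=> e; apply/eq_coset/eq_proj.
have ekx : proj I (k + x) = proj I x by rewrite pD pk; apply: (@add0b (quotient I)).
have exk : proj I (x + k) = proj I x by rewrite pD pk; apply: (@addb0 (quotient I)).
have e1 : proj I (k * x) = proj I x by rewrite pM pk; apply: (@mul1g (quotient I)).
have e2 : proj I (x * k) = proj I x by rewrite pM pk; apply: (@mulg1 (quotient I)).
rewrite !addNKb; split=> //; split.
- by apply: Id; rewrite ekx.
- by apply: Jd; rewrite z2.
- by apply: Id; rewrite ekx.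
- by apply: Jd; rewrite z1 z2.
- by apply: Id; rewrite ekx.
- exact: Jd.
Qed.

(* Modulo L the ideal K acts trivially on zeta_above L, so the defects of k in K
   with respect to x take values in K ∩ L, where K acts trivially: they are
   additive in k for both operations. *)
Lemma derived_centralises K L : K `<=` Cent L -> derived K `<=` Cent (zeta_above L).
Proof.
move=> KL; apply: smallest_sub; first exact: Cent_is_ideal.
move=> d0 [k [k' [Kk Kk' ed]]].
have KLc a y : subbrace_set K a -> subbrace_set L y -> commuting a y.
  by move=> Ka; apply: KL.
(* Conjugates of the defects of [a] stay in [L], so [b] commutes with them and the defects add
   up. *)
have add a b x f f' l l' g g' : subbrace_set K a -> subbrace_set K b ->
    subbrace_set L f -> subbrace_set L l -> subbrace_set L g ->
    [/\ a * x = a + x + f, x * a = a + x + l & x + a = a + x + g] ->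
    [/\ b * x = b + x + f', x * b = b + x + l' & x + b = b + x + g'] ->
    [/\ (a + b) * x = a + b + x + (f + f'), x * (a + b) = a + b + x + (l + l') &
        x + (a + b) = a + b + x + (g' + g)].
  move=> Ka Kb Lf Ll Lg [f1 l1 g1] [f2 l2 g2].
  have aux d : subbrace_set L d -> x + d - x + b = b + (x + d - x).
    move=> Ld; have Ld' : subbrace_set L (x + d - x).
      by have := ideal_act (OpAdd, - x) Ld; rewrite /act /= oppbK addbA.
    by have [_ _ ->] := KLc b _ Kb Ld'.
  have aux2 d d' : subbrace_set L d ->
      a + x + d - x + (b + x + d') = a + b + x + (d + d').
    move=> Ld; transitivity (a + (x + d - x + b) + x + d'); first by rewrite !addbA.
    by rewrite aux // !addbA addbNK.
  split; [by rewrite (mulDb hts) f1 f2 aux2|by rewrite mulbDr l1 l2 aux2|].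
  have [_ _ gb] := KLc b g Kb Lg.
  by rewrite addbA g1 -addbA gb addbA -[a + x + b]addbA g2 !addbA.
have mul a b x f f' l l' g g' : subbrace_set (zeta_above L) x ->
    subbrace_set K a -> subbrace_set K b ->
    subbrace_set K f' -> subbrace_set L f' -> subbrace_set K l -> subbrace_set L l ->
    subbrace_set L l' ->
    subbrace_set K g -> subbrace_set L g -> subbrace_set K g' -> subbrace_set L g' ->
    [/\ a * x = a + x + f, x * a = a + x + l & x + a = a + x + g] ->
    [/\ b * x = b + x + f', x * b = b + x + l' & x + b = b + x + g'] ->
    [/\ (a * b) * x = a * b + x + (f + f'), x * (a * b) = a * b + x + (l' + l) &
        x + a * b = a * b + x + (g' + g)].
  move=> Lx Ka Kb Kf' Lf' Kl Ll Ll' Kg Lg Kg' Lg' [f1 l1 g1] [f2 l2 g2].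
  have [af' _ _] := KLc a f' Ka Lf'.
  have [_ lb _] := KLc b l Kb Ll.
  have [ag' _ _] := KLc a g' Ka Lg'.
  have [_ _ abg] := KLc (a * b) g (subM Ka Kb) Lg.
  split.
  - by rewrite -mulgA f2 mulbDr af' mulbDr f1; addb_simp.
  - by rewrite mulgA l1 !(mulDb hts) lb l2; addb_simp.
  (* For the last equation take [y = lambda a^-1 x], so that [a * y = a + x], and evaluate
     [a * (y + b)] in two ways. *)
  have [w [_ [_ [[Kw Lw] _ _ [ew _ _]]]]] := defect_mem (subV Ka) Lx.
  pose y := x + w.
  have ay : a * y = a + x.
    have -> : y = lambda a^-1 x by rewrite /lambda ew -!addbA addKb.
    by rewrite mulb_lambda lambdaK.
  have yb : y + b = b + y + g'.
    have [_ _ bw] := KLc b w Kb Lw.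
    have [_ _ wg] := KLc w g' Kw Lg'.
    by rewrite /y -addbA bw addbA g2 -!addbA wg.
  have axa : a + x - a = x - g.
    have ang : a - g = - g + a.
      by have [_ _ ag] := KLc a g Ka Lg; apply: (@addbI _ g); rewrite addNKb addbA ag addbK.
    have -> : a + x = x + a - g by rewrite g1 addbK.
    by rewrite -(addbA x) ang addbA addbK.
  have abxg : a * b - g = - g + a * b.
    by apply: (@addbI _ g); rewrite addNKb addbA abg addbK.
  have e : a * (y + b) = x + a * b - g.
    by rewrite mulbDr ay axa -!addbA abxg.
  have : a * (y + b) = a * b + x + g'.
    rewrite yb -addbA mulbDr [a * (y + g')]mulbDr ay ag'.
    by addb_simp.
  by rewrite e => h; rewrite -[x + a * b](addbNK g) h addbA.
have swap a b : subbrace_set K a -> subbrace_set L b -> a + b = b + a.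
  by move=> Ka Lb; have [_ _ ->] := KLc a b Ka Lb.
(* Against [x], the elements [k + k'], [k * k'] and [k' + k] have the same defects up to the order
   of summands, and these commute. *)
have [ed1|ed2] := ed; [rewrite ed1|rewrite ed2];
  apply: Cent_sub_defects => // x Lx;
  have [f [l [g [[Kf Lf] [Kl Ll] [Kg Lg] E]]]] := defect_mem Kk Lx;
  have [f' [l' [g' [[Kf' Lf'] [Kl' Ll'] [Kg' Lg'] E']]]] := defect_mem Kk' Lx;
  exists (f + f'), (l + l'), (g' + g); split; try exact: add E E'.
- by rewrite (swap l l'); first exact: mul E E'.
- by rewrite (swap f f') // (swap l l') // (swap g' g) //; apply: add E' E.
Qed.

End Derived.

Section Solubility.
Variable B : skewBraceType.
Hypothesis hts : two_sided B.
Hypothesis central_factor : has_central_factors B.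
Hypothesis hia : i_artinian B.
Implicit Types K L : ideal B.

Lemma whole_is_ideal : is_ideal [set: B].
Proof. by apply/is_ideal_act. Qed.

Definition whole_ideal : ideal B := ideal_of_set whole_is_ideal.

(* Grün's argument: if the centraliser L of K = K' were proper, K would
   centralise zeta_above L > L as well. *)
Lemma perfect_ideal_eq0 K : K `<=` derived K -> K `<=` [set 0].
Proof.
move=> KK; pose L := cent_ideal hts K.
have KL : K `<=` Cent L by move=> k Kk x Lx; apply/commuting_sym/Lx.
have LT : whole_ideal `<=` L.
  apply: contrapT => no; have [x [_ nLx Lx]] := central_factor no.
  apply: nLx => k Kk; apply/commuting_sym; apply: (derived_centralises hts KL (KK k Kk)).
  exact/zeta_aboveE.
(* Now all of [B] centralises [K], so the defects of [K] are zero. *)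
apply: (subset_trans KK); apply: smallest_sub; first exact: zero_is_ideal.
move=> d [a [b [Ka Kb ed]]]; have [e1 _ e3] := LT a Logic.I b Kb.
by case: ed => ->; rewrite /= ?e1 ?e3 addNb.
Qed.

Definition derived_series (n : nat) : ideal B := iter n (fun K : ideal B => derived K) whole_ideal.

Lemma derived_series_eq0 : exists N, derived_series N = [set 0] :> set B.
Proof.
have [n|N eN] := hia (I := derived_series); first exact: derived_sub.
exists N; apply/seteqP; split; last by move=> _ ->; apply: sub0.
by apply: perfect_ideal_eq0; rewrite -[derived _]/(derived_series N.+1) eN.
Qed.

Lemma abelian_section (J I : ideal B) : defects J `<=` I ->
  abelian_brace (section_brace J I).
Proof.
move=> JI; rewrite /abelian_brace; apply/seteqP; split=> // q _ r.
rewrite /section_brace in q r *.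
set P := preim_ideal _ I in q r *; have [pD pM] := proj_morph P.
have [a ->] := proj_surj q; have [b ->] := proj_surj r.
have eM c d : proj P (c * d) = proj P (c + d) :> quotient P.
  apply/eq_proj/esym/eq_coset; apply: JI; exists (incl c), (incl d); split; try exact: svalP.
  by left.
have eD c d : proj P (d + c) = proj P (c + d) :> quotient P.
  apply/eq_proj/esym/eq_coset; apply: JI; exists (incl c), (incl d); split; try exact: svalP.
  by right.
by rewrite -!(pD, pM) !eM (eD a b).
Qed.

Lemma central_factor_soluble : soluble_brace B.
Proof.
have [N eN] := derived_series_eq0.
exists N, (fun j => derived_series (N - j)); split.
- by rewrite subn0.
- by rewrite subnn.
move=> j ltj; have -> : (N - j = (N - j.+1).+1)%N by rewrite -subSn.
split; first exact: derived_sub.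
by apply: abelian_section; apply: defects_sub.
Qed.

End Solubility.

(** * Chain condition for additive subgroups *)

(** Bundling the commutativity lets the carrier receive a canonical [zmodType] structure. *)
Record commutative_ideal (B : skewBraceType) := CommutativeIdeal {
  ci_ideal :> ideal B;
  ciC : forall x y, subbrace_set ci_ideal x -> subbrace_set ci_ideal y ->
    x + y = y + x }.

Section CommutativeIdealZmodule.
Variables (B : skewBraceType) (A : commutative_ideal B).

Definition ci_type : Type := {x : B | subbrace_set A x}.

Lemma ci_inj (u v : ci_type) : sval u = sval v -> u = v.
Proof. by case: u v => [x Ax] [y Ay] /= e; subst y; rewrite (Prop_irrelevance Ax Ay). Qed.

Definition ci_zero : ci_type := exist _ _ (sub0 A).
Definition ci_add (u v : ci_type) : ci_type :=
  exist _ _ (subD (svalP u) (svalP v)).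
Definition ci_opp (u : ci_type) : ci_type := exist _ _ (subN (svalP u)).

Fact ci_addA : associative ci_add.
Proof. by move=> u v w; apply: ci_inj; apply: addbA. Qed.
Fact ci_addC : commutative ci_add.
Proof. by move=> u v; apply: ci_inj; apply: ciC; apply: svalP. Qed.
Fact ci_add0 : left_id ci_zero ci_add.
Proof. by move=> u; apply: ci_inj; apply: add0b. Qed.
Fact ci_addN : left_inverse ci_zero ci_opp ci_add.
Proof. by move=> u; apply: ci_inj; apply: addNb. Qed.

HB.instance Definition _ := gen_eqMixin ci_type.
HB.instance Definition _ := gen_choiceMixin ci_type.
HB.instance Definition _ :=
  GRing.isZmodule.Build ci_type ci_addA ci_addC ci_add0 ci_addN.

End CommutativeIdealZmodule.

Section FiniteActions.
Variable B : skewBraceType.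
Hypothesis hts : two_sided B.

Lemma act_inj o : injective (@act B o).
Proof.
case: o => -[] a x y; rewrite /act /=.
- by move/(congr1 (lambda a^-1)); rewrite !lambdaVK.
- by move/addbI/addbIr.
- exact: conjg_inj.
Qed.

(** Composites can be sorted into one operator of each kind: conjugations pass the other operators
    by transforming their parameters. Precomposing with any operator thus keeps the shape. *)
Lemma act_swap (a b c : B) o : exists a' b' c', forall x,
  act (OpAdd, c) (act (OpMul, b) (act (OpLambda, a) (act o x))) =
  act (OpAdd, c') (act (OpMul, b') (act (OpLambda, a') x)).
Proof.
case: o => -[] d.
- by exists (a * d), b, c => x; rewrite /act /= lambdaM.
- exists a, b, (lambda a d ^ b + c) => x; rewrite /act /=.
  have cD := conjD hts; have cN u v : (- u) ^ v = - (u ^ v) := actN hts (OpMul, v) u.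
  rewrite !lambdaD lambdaN; move: (lambda a d) (lambda a x) => p q.
  by rewrite !cD cN; addb_simp.
- exists (a ^ d^-1), (d * b), c => x; rewrite /act /= conjgM.
  by rewrite (conj_lambda hts d) conjgKV.
Qed.

(** [b] counts only through its table of values on the finite stable set [X]. There are finitely
    many tables, and [R] holds one element for each. *)
Lemma finite_action_reps (X : ideal B) : finite_set X ->
  exists R : set B, finite_set R /\ forall b, exists2 r, R r &
    forall k x, subbrace_set X x -> act (k, b) x = act (k, r) x.
Proof.
move=> fX; have /finite_seqP[s es] := fX.
pose F (b x : B) := (act (OpLambda, b) x, act (OpAdd, b) x, act (OpMul, b) x).
have fF x : subbrace_set X x -> finite_set (range (F^~ x)).
  move=> Xx; apply: sub_finite_set (finite_setX (finite_setX fX fX) fX).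
  by move=> _ [b _ <-]; split; first split; apply: (ideal_act (I := X)).
have fmap : finite_set (range (fun b => [seq F b x | x <- s])).
  have : {subset s <= s} by [].
  elim: {1 3}s => [_|x t IHt sub] /=.
    by apply: sub_finite_set (finite_set1 [::]) => _ [b _ <-].
  apply: sub_finite_set (finite_image2 (fun u v => u :: v) (fF x _) (IHt _)).
  - by move=> _ [b _ <-]; exists (F b x); [exists b|exists [seq F b y | y <- t]; [exists b|]].
  - by rewrite es /=; apply: sub; rewrite mem_head.
  - by move=> y yt; apply: sub; rewrite inE yt orbT.
have /choice[g gP] : forall y, exists b,
    range (fun b => [seq F b x | x <- s]) y -> [seq F b x | x <- s] = y.
  move=> y; have [[b _ <-]|no] := pselect (range (fun b => [seq F b x | x <- s]) y).
    by exists b.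
  by exists 0.
exists (g @` range (fun b => [seq F b x | x <- s])); split; first exact: finite_image.
move=> b; exists (g [seq F b x | x <- s]); first by exists [seq F b x | x <- s].
have /eq_in_map e : [seq F (g [seq F b x | x <- s]) x | x <- s] = [seq F b x | x <- s].
  by apply: gP; exists b.
move=> k x; rewrite es /= => /e[e1 e2 e3].
by case: k; rewrite ?e1 ?e2 ?e3.
Qed.

End FiniteActions.

Section CommutativeIdeals.
Variable B : skewBraceType.
Hypothesis hts : two_sided B.
Hypothesis central_factor : has_central_factors B.
Hypothesis hia : i_artinian B.
Variable A : commutative_ideal B.

Local Notation V := (ci_type A).
Local Notation O := (op_kind * B)%type.

Definition ci_act (o : O) (v : V) : V := exist _ _ (ideal_act o (svalP v)).

Lemma ci_actB o : {morph ci_act o : u v / (u - v)%R}.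
Proof.
by move=> u v; apply: ci_inj; rewrite /= (actD hts) (actN hts).
Qed.

Lemma zinv_is_ideal (H : set V) : zinv ci_act H -> is_ideal (sval @` H : set B).
Proof.
move=> [sH iH]; apply/is_ideal_act; split; first apply/asubP; first split.
- by exists 0%R => //; apply: zsub0.
- by move=> _ _ [u Hu <-] [v Hv <-]; exists (u + v)%R => //; apply: zsubD.
- by move=> _ [u Hu <-]; exists (- u)%R => //; apply: zsubN.
- by move=> o _ [u Hu <-]; exists (ci_act o u) => //; apply: iH.
Qed.

Definition zinv_ideal H (iH : zinv ci_act H) : ideal B :=
  ideal_of_set (zinv_is_ideal iH).

Lemma sval_image_sub (H K : set V) :
  (sval @` H : set B) `<=` sval @` K -> H `<=` K.
Proof.
move=> sub u Hu; have [|v Kv /ci_inj <- //] := sub (sval u).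
by exists u.
Qed.

Lemma dcc_ci_zinv : dcc (zinv ci_act).
Proof.
move=> H iH dH; have [||N st] := dcc_is_ideal hia (H := fun n => sval @` H n : set B).
- by move=> n; apply: zinv_is_ideal.
- by move=> n; apply: image_subset.
exists N => n le; have /= e := st n le.
by apply/seteqP; split; apply: sval_image_sub; rewrite e.
Qed.

Lemma ci_central_factor (K L : set V) : zinv ci_act K -> zinv ci_act L ->
  ~ L `<=` K ->
  exists x, [/\ L x, ~ K x & forall o, K (ci_act o x - x)%R].
Proof.
move=> iK iL nLK.
have [|_ [[x Lx <-] nKx Kx]] := central_factor (K := zinv_ideal iK) (L := zinv_ideal iL).
  by move/sval_image_sub.
exists x; split=> // [Kx'|o]; first by apply: nKx; exists x.
by have [y Ky ey] := Kx o; rewrite (_ : (_ - _)%R = y) //; apply: ci_inj; rewrite ey.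
Qed.

(* By the minimal condition the centraliser of U is the centraliser of some
   finite X inside U; the operations of b on U only depend on b modulo it. *)
Lemma ci_finite_action (U : set V) : zinv ci_act U ->
    (forall x, U x -> exists X, [/\ zinv ci_act X, finite_set X, X `<=` U & X x]) ->
  exists G : set (V -> V),
    [/\ finite_set G,
        forall g, G g -> injective g /\ {morph g : x y / (x - y)%R},
        forall o g, G g ->
          exists2 g', G g' & forall x, U x -> g (ci_act o x) = g' x
      & exists2 g, G g & forall x, U x -> g x = x].
Proof.
move=> iU finU.
pose P I := exists X, [/\ zinv ci_act X, finite_set X, X `<=` U
                        & I = Cent (sval @` X : set B)].
have [||C [[X0 [iX0 fX0 X0U eC]] minC]] := @dcc_minimal _ P (Cent (sval @` [set 0%R : V])).
- apply: dcc_sub (dcc_is_ideal hia) => _ [X [iX _ _ ->]].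
  exact: (Cent_is_ideal hts (zinv_ideal iX)).
- exists [set 0%R]; split=> //; first exact: (zinv0 ci_actB).
  by move=> _ ->; apply: zsub0; apply: zinv_zsub iU.
have Cmin X : zinv ci_act X -> finite_set X -> X `<=` U -> C `<=` Cent (sval @` X : set B).
  move=> iX fX XU; pose Y := zadd X X0.
  have iY : zinv ci_act Y by apply: zinv_zadd => //; apply: ci_actB.
  have sX := zinv_zsub iX; have sX0 := zinv_zsub iX0.
  have eY : Cent (sval @` Y : set B) = C.
    apply: minC.
      exists Y; split=> //; first exact: finite_zadd.
      by move=> _ [u Xu [v Xv <-]]; apply: zsubD; [apply: zinv_zsub iU|apply: XU|apply: X0U].
    rewrite eC => c Cc _ [u Xu <-]; apply: Cc; exists u => //.
    exact: (zaddr sX Xu).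
  rewrite -eY => c Cc _ [u Xu <-]; apply: Cc; exists u => //.
  exact: (zaddl sX0 Xu).
have [R [fR RP]] : exists R : set B, finite_set R /\ forall b, exists2 r, R r &
    forall k u, U u -> ci_act (k, b) u = ci_act (k, r) u.
  have fX0' : finite_set (zinv_ideal iX0) by apply: finite_image.
  have [R [fR RP]] := finite_action_reps fX0'.
  exists R; split=> // b; have [r Rr rP] := RP b; exists r => // k u Uu.
  have [X [iX fX XU Xu]] := finU u Uu; apply: ci_inj.
  (* Agreement on [X0] puts [- b + r] into the minimal centraliser [C], which centralises every
     finite submodule of [U], in particular one containing [u]. *)
  have Crb : C (- b + r) by rewrite eC; apply/(Cent_subP hts (zinv_ideal iX0)).
  have := Cmin X iX fX XU _ Crb; move/(Cent_subP hts (zinv_ideal iX)); apply.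
  by exists u.
pose g (t : B * B * B) (v : V) :=
  ci_act (OpAdd, t.2) (ci_act (OpMul, t.1.2) (ci_act (OpLambda, t.1.1) v)).
have actU o u : U u -> U (ci_act o u) by case: iU => _; apply.
have gR a b c : exists2 t, (R `*` R `*` R) t & forall u, U u -> g (a, b, c) u = g t u.
  have [a' Ra ea] := RP a; have [b' Rb eb] := RP b; have [c' Rc ec] := RP c.
  exists (a', b', c') => // u Uu; rewrite /g /= ec; last by exact: (actU _ _ (actU _ _ Uu)).
  by rewrite eb ?ea //; apply: actU.
exists (g @` (R `*` R `*` R)); split.
- by apply: finite_image; do 2 apply: finite_setX => //.
- move=> _ [t _ <-]; split; last by move=> u v; rewrite /g !ci_actB.
  move=> u v /(congr1 sval) /= e; apply: ci_inj.
  by move: e => /act_inj/act_inj/act_inj.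
- move=> o _ [[[a b] c] _ <-]; have [a' [b' [c' e]]] := act_swap hts a b c o.
  have [t Rt et] := gR a' b' c'; exists (g t); first by exists t.
  by move=> u Uu; rewrite -et //; apply: ci_inj; apply: e.
- have [t Rt et] := gR 0 0 0; exists (g t); first by exists t.
  move=> u Uu; rewrite -et //; apply: ci_inj.
  by rewrite /= /act /= lambda1 conjg1 addb0 oppb0 add0b.
Qed.

Lemma dcc_commutative_ideal : dcc (@zsub V).
Proof.
apply: (dcc_operator_group ci_actB); first exact: dcc_ci_zinv.
  exact: ci_central_factor.
exact: ci_finite_action.
Qed.

End CommutativeIdeals.

Section Quotient.
Variables (B : skewBraceType) (I : ideal B).
Let pM := proj_morph I.

Lemma i_artinian_quotient : i_artinian B -> i_artinian (quotient I).
Proof.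
move=> hia J dJ; have [|N st] := hia (fun n => preim_ideal pM (J n)).
  by move=> n x; apply: dJ.
exists N => n le; apply/seteqP.
have e : forall x, subbrace_set (J n) (proj I x) = subbrace_set (J N) (proj I x).
  by move=> x; have /(congr1 (fun X : set B => X x)) := st n le.
by split=> q; have [x ->] := proj_surj q; rewrite e.
Qed.

Lemma central_factors_quotient :
  has_central_factors B -> has_central_factors (quotient I).
Proof.
move=> cf K L nLK.
have [|x [Lx nKx Kx]] := cf (preim_ideal pM K) (preim_ideal pM L).
  move=> sub; apply: nLK => q; have [x ->] := proj_surj q; exact: sub.
exists (proj I x); split=> // -[k q]; have [a ->] := proj_surj q.
have := Kx (k, a); rewrite /= /preimage /= (proj1 pM) (morphN pM).
by rewrite (act_morph k a x pM).
Qed.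

Lemma image_is_ideal (J : ideal B) :
  is_ideal ((proj I : B -> quotient I) @` J).
Proof.
apply/is_ideal_act; split; first apply/asubP; first split.
- by exists 0 => //; apply: sub0.
- move=> _ _ [x Jx <-] [y Jy <-]; exists (x + y); first exact: subD.
  by rewrite (proj1 pM).
- by move=> _ [x Jx <-]; exists (- x); [apply: subN|rewrite (morphN pM)].
- move=> [k q] _ [x Jx <-]; have [a ->] := proj_surj q.
  by exists (act (k, a) x); [apply: ideal_act|rewrite (act_morph k a x pM)].
Qed.

End Quotient.

Section AdditiveSubgroups.
Variable B : skewBraceType.
Hypothesis hts : two_sided B.
Hypothesis central_factor : has_central_factors B.
Hypothesis hia : i_artinian B.

(** [J / I] is additively commutative, so the images in it of the groups [H n] cut with [J] become
    stationary. Elements with equal image differ by an element of [I], where the chain is stationary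
    already. *)
Lemma stationary_section (J I : ideal B) (H : nat -> set B) :
    defects J `<=` I -> (forall n, asub (H n)) -> decreasing_chain H ->
  stationary (fun n => H n `&` I) -> stationary (fun n => H n `&` J).
Proof.
move=> JI sH dH [m1 st1].
have pM := proj_morph I; have [pD _] := pM; have pN := morphN pM.
have comm p q : (proj I @` J : set (quotient I)) p ->
    (proj I @` J : set (quotient I)) q -> p + q = q + p.
  move=> [x Jx <-] [y Jy <-]; rewrite -!pD; apply/eq_proj/eq_coset; apply: JI.
  by exists x, y; split=> //; right.
pose A := @CommutativeIdeal _ (ideal_of_set (image_is_ideal I J)) comm.
have dA : dcc (@zsub (ci_type A)).
  apply: (dcc_commutative_ideal (two_sided_quotient hts (I := I))).
    exact: central_factors_quotient.
  exact: i_artinian_quotient.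
pose K n : set (ci_type A) :=
  [set v | exists2 h, H n h /\ subbrace_set J h & proj I h = sval v].
have [||m2 st2] := dA K.
- move=> n; split; first by exists 0 => //; split; [apply: asub0|apply: sub0].
  move=> u v [h [Hh Jh] eh] [h' [Hh' Jh'] eh'].
  exists (h - h'); last by rewrite pD pN eh eh'.
  by split; [apply: asubB|apply: subD => //; apply: subN].
- by move=> n v [h [Hh Jh] eh]; exists h => //; split=> //; apply: dH.
exists (maxn m1 m2) => n; rewrite geq_max => /andP[le1 le2].
have le1' := leq_maxl m1 m2; have le2' := leq_maxr m1 m2.
apply/seteqP; split; first by apply: setSI; apply: decreasing_chain_le; rewrite // geq_max le1.
move=> x [Hx Jx]; split=> //.
have px : (proj I @` J : set (quotient I)) (proj I x) by exists x.
have : K (maxn m1 m2) (exist _ (proj I x) px) by exists x.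
rewrite (st2 _ le2') -(st2 _ le2) => -[h [Hh Jh] /= eh].
have Ihx : subbrace_set I (- h + x) by apply/eq_coset/eq_proj.
have : (H (maxn m1 m2) `&` I) (- h + x).
  split=> //; apply: asubD => //; apply: asubN => //.
  by apply: (decreasing_chain_le dH) Hh; rewrite geq_max le1.
rewrite (st1 _ le1') -(st1 _ le1) => -[Hhx _].
by rewrite -(addNKb h x); apply: asubD.
Qed.

Lemma dcc_asub : dcc (@asub B).
Proof.
move=> H sH dH; have [N eN] := derived_series_eq0 hts central_factor hia.
(* Climb the derived series from its zero term up to [B], one section at a time. *)
suff st j : (j <= N)%N -> stationary (fun n => H n `&` derived_series B (N - j)).
  have [m st_m] := st N (leqnn N); exists m => n le; have := st_m n le.
  by rewrite subnn !setIT.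
elim: j => [_|j IHj ltj].
  exists 0%N => n _; rewrite subn0 eN; apply/seteqP.
  by split=> _ [_ ->]; split=> //; apply: asub0.
apply: (@stationary_section _ (derived_series B (N - j))) => //; last exact: IHj (ltnW ltj).
have -> : (N - j = (N - j.+1).+1)%N by rewrite -subSn.
exact: defects_sub.
Qed.

End AdditiveSubgroups.

Theorem theorem3p13 (B : skewBraceType)
    (hlm : locally_multipermutational B) (hts : two_sided B)
    (hia : i_artinian B) :
  s_artinian B /\ (hypercentral B /\ soluble_brace B).
Proof.
have cf : has_central_factors B := exists_central_factor hts hlm hia.
split; last by split; [apply: central_factor_hypercentral|apply: central_factor_soluble].
move=> S dS; apply: (dcc_asub hts cf hia) => // n.
by have [] := subbraceP (S n).
Qed.
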